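(* Let $W_1,W_2,W$ be generalized $V$-modules, $z$ a nonzero complex number, and $F:W_1\otimes W_2\to W^*$ a linear map. Then $F$ is a $P(z)$-intertwining map of type $\binom{W'}{W_1\,W_2}$ if and only if $F(W_1\otimes W_2)\subset\mathcal D_{P(z)}(W)$ and $F$ is a $V\otimes V$-homomorphism from $W_1\otimes W_2$ to $(\mathcal D_{P(z)}(W),Y_{P(z)})$. Equivalently, the space of $P(z)$-intertwining maps of type $\binom{W'}{W_1\,W_2}$ equals $\mathrm{Hom}_{V\otimes V}(W_1\otimes W_2,\mathcal D_{P(z)}(W))$.
   Context: $V$ is a vertex operator algebra with vacuum $\mathbf 1$, Virasoro element $\omega$, $Y(\omega,x)=\sum_{n}L(n)x^{-n-2}$; $V\otimes V$ is the tensor product vertex operator algebra with $Y(u\otimes v,x)=Y(u,x)\otimes Y(v,x)$. The formal delta function is $\delta(x)=\sum_{n\in\mathbb Z}x^n$; binomial expressions $(x_1-x_2)^n$ are expanded in nonnegative powers of the second variable. A weak $V$-module is a vector space $W$ with $Y_W:V\to(\mathrm{End}\,W)[[x,x^{-1}]]$ such that $Y_W(v,x)w\in W((x))$, $Y_W(\mathbf 1,x)=\mathrm{id}$, and the Jacobi identity $x_0^{-1}\delta(\frac{x_1-x_2}{x_0})Y_W(u,x_1)Y_W(v,x_2)-x_0^{-1}\delta(\frac{x_2-x_1}{-x_0})Y_W(v,x_2)Y_W(u,x_1)=x_2^{-1}\delta(\frac{x_1-x_0}{x_2})Y_W(Y(u,x_0)v,x_2)$ holds. A generalized $V$-module is a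 weak $V$-module $W=\coprod_{h\in\mathbb C}W_{(h)}$ on which $L(0)$ acts semisimply ($W_{(h)}$ the $h$-eigenspace). For generalized modules $W_1,W_2$, $W_1\otimes W_2$ is a weak $V\otimes V$-module via $Y(u\otimes v,x)=Y_{W_1}(u,x)\otimes Y_{W_2}(v,x)$. The restricted dual is $W'=\coprod_h W_{(h)}^*$, so $W^*=\prod_hW_{(h)}^*$. For $v\in V$ set $Y^o(v,x)=Y_W(e^{xL(1)}(-x^{-2})^{L(0)}v,x^{-1})$, and for $\alpha\in W^*$ define $Y^*(v,x)\alpha\in W^*[[x,x^{-1}]]$ by $\langle Y^*(v,x)\alpha,w\rangle=\langle\alpha,Y^o(v,x)w\rangle$. A $P(z)$-intertwining map of type $\binom{W'}{W_1\,W_2}$ is a linear map $F:W_1\otimes W_2\to W^*$ such that for all $v\in V$, $w_{(1)}\in W_1$, $w_{(2)}\in W_2$: $x_0^{-1}\delta(\frac{x_1-z}{x_0})Y^*(v,x_1)F(w_{(1)}\otimes w_{(2)})-x_0^{-1}\delta(\frac{z-x_1}{-x_0})F(w_{(1)}\otimes Y(v,x_1)w_{(2)})=z^{-1}\delta(\frac{x_1-x_0}{z})F(Y(v,x_0)w_{(1)}\otimes w_{(2)})$. An element $\alpha\in W^*$ is a $P(z)$-linear functional if for all $v\in V,w\in W$ the series $\langle\alpha,Y^o(v,x)w\rangle$ converges absolutely in $|x|>|z|$ to a rational function in $\mathbb C[x,x^{-1},(x-z)^{-1}]$, with pole orders at $0$ and $z$ bounded independently of $w$ for fixed $v$; $\mathcal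 D_{P(z)}(W)$ is the space of these. With $\iota_{x;\infty},\iota_{x;0}$ the Laurent expansion maps of rational functions at $x=\infty$ and $x=0$, and $f_{v,\alpha,w}=\iota_{x;\infty}^{-1}\langle\alpha,Y^o(v,x)w\rangle$, define $\langle Y^R_{P(z)}(v,x)\alpha,w\rangle=\iota_{x;0}f_{v,\alpha,w}(x)$, $\langle Y^L_{P(z)}(v,x)\alpha,w\rangle=\iota_{x;0}\big(f_{v,\alpha,w}(x+z)\big)$, and $Y_{P(z)}(u\otimes v,x)=Y^L_{P(z)}(u,x)Y^R_{P(z)}(v,x)$; $(\mathcal D_{P(z)}(W),Y_{P(z)})$ is a weak $V\otimes V$-module. *)

(* Defs.v *)
From HB Require Import structures.
From mathcomp Require Import all_boot all_order all_algebra.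
From mathcomp Require Import complex.
From mathcomp Require Import boolp reals.
Set Implicit Arguments.
Unset Strict Implicit.
Unset Printing Implicit Defensive.
Import Order.TTheory GRing.Theory Num.Theory.
Local Open Scope ring_scope.

Section Defs.
Variable R : realType.
Local Notation C := R[i].

(* Finite sums of eventually-zero families (used for coefficient extraction  *)
(* of products of formal series; all sums used below are finite).            *)
Definition fsumn (M : nmodType) (a : nat -> M) : M :=
  match pselect (exists N : nat, forall k, (N <= k)%N -> a k = 0) with
  | left H => \sum_(k < projT1 (cid H)) a k
  | right _ => 0
  end.

Definition fsumz (M : nmodType) (a : int -> M) : M :=
  fsumn (fun k => a (Posz k)) + fsumn (fun k => a (Negz k)).

Definition binz (m : int) (i : nat) : C :=
  (\prod_(j < i) (m%:~R - (j : nat)%:R)) / (i`!)%:R.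

Definition normC (x : C) : R := ComplexField.Normc.normc x.

Definition cvgR (s : nat -> R) (L : R) :=
  forall e : R, 0 < e -> exists N : nat, forall n, (N <= n)%N -> `|s n - L| < e.
Definition cvgC (s : nat -> C) (L : C) :=
  forall e : R, 0 < e -> exists N : nat, forall n, (N <= n)%N -> normC (s n - L) < e.
Definition abs_summable (a : nat -> C) :=
  exists S : R, cvgR (fun n => \sum_(k < n) normC (a k)) S.
Definition sums_to (a : nat -> C) (L : C) := cvgC (fun n => \sum_(k < n) a k) L.

Definition abs_conv_Z (c : int -> C) (L : C) :=
  [/\ abs_summable (fun k => c (Posz k)), abs_summable (fun k => c (Negz k)) &
      exists L1 L2, [/\ sums_to (fun k => c (Posz k)) L1,
                        sums_to (fun k => c (Negz k)) L2 & L = L1 + L2]].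

(* Vertex operators are given by their modes: Y v n w = v_n w, i.e.         *)
(* Y(v,x) = sum_n v_n x^{-n-1}.                                             *)
Section Modules.
Variables (V : lmodType C) (Y : V -> int -> V -> V) (vac om : V).

Definition linear_fun (M : lmodType C) (alpha : M -> C) :=
  forall (a : C) (w1 w2 : M), alpha (a *: w1 + w2) = a * alpha w1 + alpha w2.

Definition bilinear_modes (M : lmodType C) (YM : V -> int -> M -> M) :=
  (forall v n (a : C) (w1 w2 : M), YM v n (a *: w1 + w2) = a *: YM v n w1 + YM v n w2) /\
  (forall n (w : M) (a : C) (v1 v2 : V), YM (a *: v1 + v2) n w = a *: YM v1 n w + YM v2 n w).

Definition truncation (M : lmodType C) (YM : V -> int -> M -> M) :=
  forall (v : V) (w : M), exists N : int, forall n : int, N <= n -> YM v n w = 0.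

Definition vacuum_id (M : lmodType C) (YM : V -> int -> M -> M) :=
  forall (n : int) (w : M), YM vac n w = if n == -1 then w else 0.

(* The Jacobi identity, written out coefficientwise: coefficient of
   x0^{-l-1} x1^{-m-1} x2^{-n-1} (Borcherds identity). *)
Definition jacobi (M : lmodType C) (YM : V -> int -> M -> M) :=
  forall (u v : V) (w : M) (l m n : int),
    fsumn (fun i => binz m i *: YM (Y u (l + i%:Z) v) (m + n - i%:Z) w) =
    fsumn (fun i => ((-1) ^+ i * binz l i) *:
             (YM u (l + m - i%:Z) (YM v (n + i%:Z) w)
              - ((-1 : C) ^ l) *: YM v (l + n - i%:Z) (YM u (m + i%:Z) w))).

Definition is_weak_module (M : lmodType C) (YM : V -> int -> M -> M) :=
  [/\ bilinear_modes YM, truncation YM, vacuum_id YM & jacobi YM].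

(* Virasoro operators: Y(omega,x) = sum_n L(n) x^{-n-2} *)
Definition Lop (M : lmodType C) (YM : V -> int -> M -> M) (n : int) : M -> M :=
  YM om (n + 1).

Definition graded_V :=
  [/\ (forall v : V, exists s : seq (int * V),
         v = \sum_(p <- s) p.2 /\ forall p, p \in s -> Lop Y 0 p.2 = p.1%:~R *: p.2),
      (forall n : int, exists b : seq V, forall v : V, Lop Y 0 v = n%:~R *: v ->
         exists c : nat -> C, v = \sum_(i < size b) c i *: b`_i) &
      (exists N : int, forall (n : int) (v : V), n < N -> Lop Y 0 v = n%:~R *: v -> v = 0)].

Definition is_VOA :=
  [/\ is_weak_module Y,
      (forall v : V, (forall n : int, 0 <= n -> Y v n vac = 0) /\ Y v (-1) vac = v),
      (exists c : C, forall (m n : int) (v : V),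
         Lop Y m (Lop Y n v) - Lop Y n (Lop Y m v) =
         (m - n)%:~R *: Lop Y (m + n) v
         + (if m + n == 0 then (c / 12%:R * (m ^+ 3 - m)%:~R) *: v else 0)),
      (* L(-1)-derivative property: Y(L(-1)v,x) = d/dx Y(v,x) *)
      (forall (v : V) (n : int) (w : V), Y (Lop Y (-1) v) n w = - (n%:~R) *: Y v (n - 1) w) &
      graded_V].

Definition is_gen_module (M : lmodType C) (YM : V -> int -> M -> M) :=
  is_weak_module YM /\
  forall w : M, exists s : seq (C * M),
    w = \sum_(p <- s) p.2 /\ forall p, p \in s -> Lop YM 0 p.2 = p.1 *: p.2.

Definition hom_decomp (v : V) : seq (int * V) :=
  match pselect (exists s : seq (int * V),
         v = \sum_(p <- s) p.2 /\ forall p, p \in s -> Lop Y 0 p.2 = p.1%:~R *: p.2) with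
  | left H => projT1 (cid H)
  | right _ => [::]
  end.

(* Y^o(v,x) = Y_W(exp(x L(1)) (-x^(-2))^(L(0)) v, x^(-1)); coefficient of x^p,
   first for v homogeneous of weight n, then extended linearly. *)
Definition Yo_hom (M : lmodType C) (YM : V -> int -> M -> M)
    (n : int) (v : V) (p : int) (w : M) : M :=
  fsumn (fun k : nat => ((-1 : C) ^ n / (k`!)%:R) *:
                         YM (iter k (Lop Y 1) v) (p - k%:Z + 2 * n - 1) w).

Definition Yo (M : lmodType C) (YM : V -> int -> M -> M) (v : V) (p : int) (w : M) : M :=
  \sum_(q <- hom_decomp v) Yo_hom YM q.1 q.2 p w.

(* P(z)-intertwining maps.  W^* = full dual of W (= prod_h of the W_(h)^* ); a *)
(* linear map F : W1 (x) W2 -> W^* is given as the bilinear map             *)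
(* (w1,w2) |-> F w1 w2 : W -> C.  Identities in W^*[[...]] are checked by   *)
(* pairing with every w in W and comparing coefficients of x0^{-l-1} x1^r.  *)
Section Intertwining.
Variables (W1 W2 W : lmodType C)
  (Y1 : V -> int -> W1 -> W1) (Y2 : V -> int -> W2 -> W2) (YW : V -> int -> W -> W)
  (z : C).

Definition bilinear_dual (F : W1 -> W2 -> W -> C) :=
  [/\ (forall a w1 w1' w2 w, F (a *: w1 + w1') w2 w = a * F w1 w2 w + F w1' w2 w),
      (forall a w1 w2 w2' w, F w1 (a *: w2 + w2') w = a * F w1 w2 w + F w1 w2' w) &
      (forall w1 w2, linear_fun (F w1 w2))].

Definition is_intertwining (F : W1 -> W2 -> W -> C) :=
  forall (v : V) (w1 : W1) (w2 : W2) (w : W) (l r : int),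
    (* x0^{-1} delta((x1-z)/x0) Y^*(v,x1) F(w1 (x) w2) *)
    fsumn (fun i => binz l i * (- z) ^+ i * F w1 w2 (Yo YW v (r - l + i%:Z) w))
    (* - x0^{-1} delta((z-x1)/(-x0)) F(w1 (x) Y(v,x1) w2) *)
    - (-1) ^ l * fsumn (fun i => binz l i * z ^ (l - i%:Z) * (-1) ^+ i
                                 * F w1 (Y2 v (i%:Z - r - 1) w2) w)
    (* = z^{-1} delta((x1-x0)/z) F(Y(v,x0) w1 (x) w2) *)
    = fsumn (fun i => z ^ (- r - i%:Z - 1) * binz (r + i%:Z) i * (-1) ^+ i
                      * F (Y1 v (l + i%:Z) w1) w2 w).

(* A rational function of C[x,x^-1,(x-z)^-1] with pole orders <= a at 0 and *)
(* <= b at z is written P(x) / (x^a (x-z)^b), P a polynomial.              *)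
Definition ratfun (P : {poly C}) (a b : nat) (x : C) : C :=
  P.[x] / (x ^+ a * (x - z) ^+ b).

Definition represents (v : V) (alpha : W -> C) (w : W) (f : {poly C} * nat * nat) :=
  forall x : C, normC z < normC x ->
    abs_conv_Z (fun p : int => alpha (Yo YW v p w) * x ^ p) (ratfun f.1.1 f.1.2 f.2 x).

Definition is_PZ_linear (alpha : W -> C) :=
  linear_fun alpha /\
  forall v : V, exists a b : nat, forall w : W, exists P : {poly C}, represents v alpha w (P, a, b).

Definition fsel (v : V) (alpha : W -> C) (w : W) : {poly C} * nat * nat :=
  match pselect (exists f, represents v alpha w f) with
  | left H => projT1 (cid H)
  | right _ => (0, 0%N, 0%N)
  end.

(* coefficient of x^r in the Laurent expansion at x = 0 of
   Q(x) x^{-m} (x + c)^{-n}   (c <> 0) *)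
Definition iota0 (Q : {poly C}) (m n : nat) (c : C) (r : int) : C :=
  \sum_(d < size Q)
    (if (0 <= r + m%:Z - d%:Z :> int)%R
     then Q`_d * binz (- n%:Z) (absz (r + m%:Z - d%:Z)%R) * c ^ (- n%:Z - (r + m%:Z - d%:Z))
     else 0).

(* coefficient of x^r of <Y^R_{P(z)}(v,x) alpha, w> = iota_{x;0} f(x) *)
Definition YR (v : V) (r : int) (alpha : W -> C) : W -> C :=
  fun w => let f := fsel v alpha w in iota0 f.1.1 f.1.2 f.2 (- z) r.

(* coefficient of x^r of <Y^L_{P(z)}(v,x) alpha, w> = iota_{x;0} f(x+z) *)
Definition YL (v : V) (r : int) (alpha : W -> C) : W -> C :=
  fun w => let f := fsel v alpha w in
           iota0 (f.1.1 \Po ('X + z%:P)) f.2 f.1.2 z r.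

(* coefficient of x^r of Y_{P(z)}(u (x) v, x) alpha = Y^L(u,x) Y^R(v,x) alpha *)
Definition YPz (u v : V) (r : int) (alpha : W -> C) : W -> C :=
  fun w => fsumz (fun t : int => YL u (r - t) (YR v t alpha) w).

(* F(W1 (x) W2) is contained in D_{P(z)}(W) and F is a V (x) V-homomorphism
   W1 (x) W2 -> (D_{P(z)}(W), Y_{P(z)}) (checked on pure tensors u (x) v and
   w1 (x) w2, which span).  Coefficient of x^r of
   Y(u (x) v, x)(w1 (x) w2) = Y(u,x)w1 (x) Y(v,x)w2 is
   sum_t u_{t-r-1} w1 (x) v_{-t-1} w2. *)
Definition is_hom_to_D (F : W1 -> W2 -> W -> C) :=
  (forall w1 w2, is_PZ_linear (F w1 w2)) /\
  forall (u v : V) (w1 : W1) (w2 : W2) (r : int) (w : W),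
    fsumz (fun t : int => F (Y1 u (t - r - 1) w1) (Y2 v (- t - 1) w2) w)
    = YPz u v r (F w1 w2) w.

End Intertwining.
End Modules.
End Defs.

(* Main.v *)
Require Import Defs.
From HB Require Import structures.
From mathcomp Require Import all_boot all_order all_algebra.
From mathcomp Require Import complex.
From mathcomp Require Import boolp reals classical_sets.
From mathcomp Require Import zify ring lra.
Import Order.TTheory GRing.Theory Num.Theory.
Local Open Scope ring_scope.
Set Implicit Arguments.
Unset Strict Implicit.
Unset Printing Implicit Defensive.

(* Fix v, w1, w2, w. The P(z)-Jacobi identity relates three scalar series: <F(w1,w2), Y^o(v,x)w>
   in C((1/x)), <F(w1,Y(v,x)w2), w> in C((x)), and <F(Y(v,x)w1,w2), w> in C((x)). It says
   precisely that they are the expansions, at infinity, at 0 and at z (in the variable x - z), of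
   one rational function in C[x, 1/x, 1/(x-z)].
   If they are such expansions, the identity is the residue theorem for x^(-r-1) (x-z)^l f(x),
   checked on monomials x^m (x-z)^n with the Vandermonde convolution. Conversely, taking l so
   large that the third term vanishes shows that (x-z)^l times the first series is a Laurent
   polynomial, and the first series determines the other two.
   Since an absolutely convergent Laurent series in 1/x determines its coefficients, this is the
   condition that F(w1,w2) is a P(z)-linear functional on which Y^R and Y^L act through the second
   and the first factor; taking u = 1 or v = 1 recovers these two actions from the action of u (x)
   v. *)

(** * Finite sums of eventually zero families *)

Section FiniteSums.
Variable M : nmodType.
Implicit Types a b : nat -> M.

(** Outside this class [fsumn] takes the default value 0, so its additivity and scaling rules are
    stated for families in it. *)
Definition ev0 a := exists N : nat, forall k, (N <= k)%N -> a k = 0.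

Lemma sum_ev0 a N N' : (forall k, (N <= k)%N -> a k = 0) -> (N <= N')%N ->
  \sum_(k < N') a k = \sum_(k < N) a k.
Proof.
move=> aN /subnKC <-; rewrite big_split_ord /= [X in _ + X]big1 ?addr0 // => i _.
by apply: aN; rewrite leq_addr.
Qed.

Lemma fsumnE N a : (forall k, (N <= k)%N -> a k = 0) -> fsumn a = \sum_(k < N) a k.
Proof.
move=> aN; rewrite /fsumn; case: pselect => [H|[]]; last by exists N.
case: (cid H) => N' /= aN'.
have [le|/ltnW le] := leqP N N'; first exact: sum_ev0.
by rewrite -(sum_ev0 aN' le).
Qed.

Lemma fsumn0 : fsumn (fun _ => 0 : M) = 0.
Proof. by rewrite (fsumnE (N := 0)) // big_ord0. Qed.

Lemma ev0_sum D (g : nat -> nat -> M) :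
  (forall d, (d < D)%N -> ev0 (g d)) -> ev0 (fun k => \sum_(d < D) g d k).
Proof.
elim: D => [_|D IH gD]; first by exists 0%N => k _; rewrite big_ord0.
have [N gN] := IH (fun d h => gD d (ltnW h)); have [N' gN'] := gD D (ltnSn D).
exists (maxn N N') => k; rewrite geq_max => /andP[h h'].
by rewrite big_ord_recr /= gN // gN' // addr0.
Qed.

Lemma fsumn_sum D (g : nat -> nat -> M) : (forall d, (d < D)%N -> ev0 (g d)) ->
  fsumn (fun k => \sum_(d < D) g d k) = \sum_(d < D) fsumn (g d).
Proof.
elim: D => [_|D IH gD]; first by rewrite (fsumnE (N := 0)) ?big_ord0 // => k _; rewrite big_ord0.
have gD' := fun d h => gD d (ltnW h).
rewrite big_ord_recr /= -IH //.
have [N gN] := ev0_sum gD'; have [N' gN'] := gD D (ltnSn D).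
rewrite (fsumnE (N := maxn N N')); last first.
  by move=> k; rewrite geq_max => /andP[h h']; rewrite big_ord_recr /= gN // gN' // addr0.
rewrite (fsumnE gN) (fsumnE gN') -(sum_ev0 gN (leq_maxl N N')) -(sum_ev0 gN' (leq_maxr N N')).
by rewrite -big_split /=; apply: eq_bigr => k _; rewrite big_ord_recr.
Qed.

Lemma fsumn_only a k0 : (forall k, k != k0 -> a k = 0) -> fsumn a = a k0.
Proof.
move=> a0; rewrite (fsumnE (N := k0.+1)); last by move=> k h; apply: a0; rewrite gtn_eqF.
rewrite big_ord_recr /= big1 ?add0r // => i _; apply: a0.
by rewrite ltn_eqF.
Qed.

Lemma fsumn_eq a b : (forall i, a i = b i) -> fsumn a = fsumn b.
Proof. by move=> /funext->. Qed.

Lemma fsumn_recl a : ev0 a -> fsumn a = a 0%N + fsumn (fun i => a i.+1).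
Proof.
move=> [N aN]; rewrite (fsumnE (N := N.+1)); last by move=> k h; apply: aN; apply: ltnW.
by rewrite big_ord_recl (fsumnE (N := N)) // => k h; apply: aN; apply: leqW.
Qed.

End FiniteSums.

Lemma fsumnB (M : zmodType) (f g : nat -> M) : ev0 f -> ev0 g ->
  fsumn (fun i => f i - g i) = fsumn f - fsumn g.
Proof.
move=> [N fN] [N' gN].
have fN' k : (maxn N N' <= k)%N -> f k = 0 by rewrite geq_max => /andP[/fN].
have gN' k : (maxn N N' <= k)%N -> g k = 0 by rewrite geq_max => /andP[_ /gN].
rewrite (fsumnE fN') (fsumnE gN') -sumrB (fsumnE (N := maxn N N')) // => k h.
by rewrite fN' // gN' // subrr.
Qed.

Lemma fsumnM (R : pzSemiRingType) (c : R) (a : nat -> R) : ev0 a ->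
  fsumn (fun k => c * a k) = c * fsumn a.
Proof.
move=> [N aN]; rewrite (fsumnE aN) (fsumnE (N := N)) ?mulr_sumr //.
by move=> k /aN->; rewrite mulr0.
Qed.

Lemma fsumz_only (M : nmodType) (a : int -> M) t0 : (forall t, t != t0 -> a t = 0) ->
  fsumz a = a t0.
Proof.
rewrite /fsumz; case: t0 => k0 a0.
  rewrite (fsumn_only (k0 := k0)); last by move=> k h; apply: a0; rewrite eqz_nat.
  by rewrite (_ : (fun k => a (Negz k)) = fun _ => 0) ?fsumn0 ?addr0 //; apply: funext => k; apply: a0.
rewrite addrC (fsumn_only (k0 := k0)); last first.
  by move=> k h; apply: a0; apply: contra h => /eqP[->].
by rewrite (_ : (fun k => a (Posz k)) = fun _ => 0) ?fsumn0 ?addr0 //; apply: funext => k; apply: a0.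
Qed.

(** * Binomial coefficients *)

Section Binomial.
Variable R : realType.
Local Notation C := R[i].
Local Notation binz := (@binz R).

Lemma binz0 m : binz m 0 = 1.
Proof. by rewrite /Defs.binz big_ord0 fact0 divr1. Qed.

Lemma binzS m i : i.+1%:R * binz m i.+1 = (m%:~R - i%:R) * binz m i.
Proof.
rewrite /Defs.binz big_ord_recr /= factS natrM.
have h1 : (i.+1)%:R != 0 :> C by rewrite pnatr_eq0.
have h2 : (i`!)%:R != 0 :> C by rewrite pnatr_eq0 -lt0n fact_gt0.
by field; rewrite nat1r h1 h2.
Qed.

Lemma binz_pascal m i : binz (m + 1) i.+1 = binz m i.+1 + binz m i.
Proof.
have n0 j : (j.+1)%:R != 0 :> C by rewrite pnatr_eq0.
elim: i => [|i IH].
  have := binzS (m + 1) 0; have := binzS m 0.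
  by rewrite !binz0 !mul1r !mulr1 !subr0 => -> ->; rewrite intrD.
apply: (mulfI (n0 i.+1)).
rewrite binzS IH [RHS]mulrDr binzS.
have := binzS m i; rewrite intrD -!natr1 => h.
rewrite [LHS](_ : _ = (m%:~R - i%:R) * binz m i.+1 + (m%:~R - i%:R) * binz m i); last by ring.
rewrite -h; ring.
Qed.

(** Extending the lower index to the integers by zero makes Pascal's rule hold for every [k], so
    Laurent coefficients need no side conditions on their range. *)
Definition bz (m k : int) : C := if 0 <= k then binz m `|k| else 0.

Lemma bz_nat m (k : nat) : bz m k = binz m k.
Proof. by []. Qed.

Lemma bz_neg m k : k < 0 -> bz m k = 0.
Proof. by rewrite /bz leNgt => ->. Qed.

Lemma bz0 m : bz m 0 = 1.
Proof. exact: binz0. Qed.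

Lemma bz0l k : bz 0 k = (k == 0)%:R.
Proof.
have [->|k0] := eqVneq k 0; first by rewrite bz0.
case: k k0 => [[//|k]|k] // _; rewrite bz_nat.
have n0 : (k.+1)%:R != 0 :> C by rewrite pnatr_eq0.
apply: (mulfI n0); rewrite binzS mulr0.
elim: k {n0} => [|k IH]; first by rewrite subrr mul0r.
by apply: (mulfI (_ : (k.+1)%:R != 0)); rewrite ?pnatr_eq0 // mulrCA binzS IH !mulr0.
Qed.

Lemma bz_pascal m k : bz (m + 1) k = bz m k + bz m (k - 1).
Proof.
case: k => [[|k]|k]; first by rewrite !bz0 bz_neg ?addr0.
  by rewrite -[in bz m (_ - _)]addn1 PoszD addrK !bz_nat binz_pascal.
by rewrite !bz_neg ?addr0 //; lia.
Qed.

Lemma int_ind_step (P : int -> Prop) : P 0 -> (forall n, P n -> P (n + 1)) ->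
  (forall n, P (n + 1) -> P n) -> forall n, P n.
Proof.
move=> P0 Pu Pd; elim/int_ind => // n Pn.
  by rewrite -addn1 PoszD; apply: Pu.
by apply: Pd; rewrite -addn1 PoszD opprD addrNK.
Qed.

(** Comparison of coefficients in (1+x)^l (1+x)^n = (1+x)^(l+n). Pascal's rule moves [l] up or down
    by one, since negative exponents occur as well. *)
Lemma vandermonde l n k :
  fsumn (fun i => binz l i * bz n (k - i%:Z)) = bz (l + n) k.
Proof.
have [k0|] := ltP k 0.
  rewrite (fsumnE (N := 0)) ?big_ord0 ?bz_neg // => i _.
  by rewrite bz_neg ?mulr0 //; lia.
case: k => // k _.
have -> : fsumn (fun i => binz l i * bz n (k%:Z - i%:Z)) = \sum_(i < k.+1) binz l i * bz n (k%:Z - i%:Z).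
  by apply: fsumnE => i h; rewrite bz_neg ?mulr0 //; lia.
elim/int_ind_step: l k => [k|l IH k|l IH k].
- rewrite big_ord_recl binz0 mul1r subr0 big1 ?addr0 ?add0r // => i _.
  by rewrite -bz_nat bz0l mul0r.
- rewrite addrAC bz_pascal -IH big_ord_recl [in RHS]big_ord_recl !binz0 -addrA; congr (_ + _).
  case: k => [|k].
    by rewrite !big_ord0 bz_neg ?addr0.
  rewrite -[in bz _ (_ - _)]addn1 PoszD addrK -IH -big_split /=; apply: eq_bigr => i _.
  rewrite ?lift0 /bump /= ?add1n binz_pascal mulrDl; congr (_ + _ * bz _ _).
  by lia.
- elim: k => [|k IHk].
    by rewrite big_ord_recl big_ord0 binz0 subrr !bz0 mul1r addr0.
  have kE : k.+1%:Z - 1 = k%:Z by rewrite -addn1 PoszD addrK.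
  (* Going down in [l] needs an inner induction on [k]: adding the previous coefficient turns the
     right side into the one for [l + 1], where [IH] applies. *)
  apply: (addIr (bz (l + n) k)); rewrite -{1}IHk -{2}kE -bz_pascal [in RHS]addrAC -IH.
  rewrite big_ord_recl [in RHS]big_ord_recl !binz0 -addrA; congr (_ + _).
  rewrite -big_split; apply: eq_bigr => i _ /=.
  rewrite /bump /= add1n binz_pascal mulrDl; congr (_ + _ * bz _ _).
  by lia.
Qed.

Lemma binz_natE (n k : nat) : binz n k = 'C(n, k)%:R.
Proof.
elim: n k => [|n IH] [|k]; rewrite ?binz0 ?bin0 //.
  by rewrite -bz_nat bz0l bin0n.
by rewrite -addn1 PoszD binz_pascal !IH addn1 binS natrD.
Qed.

Lemma exprN1S (k : int) : (-1 : C) ^ (k + 1) = - (-1) ^ k.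
Proof. by rewrite expfzDr ?oppr_eq0 ?oner_eq0 // expr1z mulrN1. Qed.

(* The residue theorem for [x ^ M * (x - 1) ^ N] : the residue at infinity is the sum of the
   residues at 0 and at 1. Both sides satisfy the recurrence coming from [x ^ M * (x - 1) ^ (N +
   1) = x ^ (M + 1) * (x - 1) ^ N - x ^ M * (x - 1) ^ N]. *)
Lemma residue_bz (M N : int) :
  (-1) ^ (M + N + 1) * (bz N (M + N + 1) - bz N (- 1 - M)) = bz M (- 1 - N).
Proof.
pose D (M N : int) := (-1) ^ (M + N + 1) * (bz N (M + N + 1) - bz N (- 1 - M)) - bz M (- 1 - N).
apply/eqP; rewrite -subr_eq0; apply/eqP; rewrite -/(D M N).
have DE M' N' : D M' (N' + 1) = D (M' + 1) N' - D M' N'.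
  rewrite /D !bz_pascal.
  rewrite (_ : M' + (N' + 1) + 1 = M' + N' + 1 + 1); last by ring.
  rewrite (_ : M' + 1 + N' + 1 = M' + N' + 1 + 1); last by ring.
  rewrite (_ : - 1 - (M' + 1) = -1 - M' - 1); last by ring.
  rewrite (_ : - 1 - (N' + 1) = -1 - N' - 1); last by ring.
  by rewrite exprN1S addrK; ring.
have D0 N' : D 0 N' = 0.
  rewrite /D add0r subr0 bz0l.
  case: N' => [n|[|n]].
  - rewrite (_ : n%:Z + 1 = n.+1); last by rewrite -addn1.
    rewrite bz_nat binz_natE bin_small // mulr0 add0r.
    by rewrite (_ : (-1 - n%:Z == 0) = false) ?oppr0 //; lia.
  - by rewrite bz0 /= mulr1 subrr.
  - rewrite bz_neg; last by lia.
    by rewrite mulr0 add0r (_ : (-1 - Negz n.+1 == 0) = false) ?oppr0 //; lia.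
elim/int_ind_step: N M => [M|N IH M|N IH M].
- rewrite /D !bz0l addr0 (_ : (-1 - M == 0) = (M + 1 == 0)); last by lia.
  by rewrite subrr mulr0 bz_neg ?subr0.
- by rewrite DE !IH subr0.
(* Since [D] vanishes at [N + 1], the recurrence makes [D M N] independent of [M], and it is 0 at
   [M = 0]. *)
- elim/int_ind_step: M => [|M h|M h]; first exact: D0.
    by have := IH M; rewrite DE h subr0.
  by have := IH M; rewrite DE h sub0r => /eqP; rewrite oppr_eq0 => /eqP.
Qed.
End Binomial.

(** * Residues of scalar Laurent series *)

Section Residues.
Variable R : realType.
Local Notation C := R[i].
Local Notation binz := (@binz R).
Local Notation bz := (@bz R).
Implicit Types A G H : int -> C.

(** With [A p] the coefficient of x^p, this condition describes C((1/x)) and the next one C((x)). *)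
Definition bounded_above A := exists N : int, forall p, N <= p -> A p = 0.
Definition bounded_below A := exists N : int, forall p, p <= N -> A p = 0.

Lemma bounded_above_ev0 A (f : nat -> C) (q : int) :
  bounded_above A -> ev0 (fun i => f i * A (q + i%:Z)).
Proof.
move=> [N AN]; exists `|N - q|%N => i h; rewrite AN ?mulr0 //.
by lia.
Qed.

Lemma bounded_below_ev0 A (f : nat -> C) (q : int) :
  bounded_below A -> ev0 (fun i => f i * A (q - i%:Z)).
Proof.
move=> [N AN]; exists `|N - q|%N => i h; rewrite AN ?mulr0 //.
by lia.
Qed.

Lemma bounded_above_sum D (c : nat -> C) (A : nat -> int -> C) :
  (forall d, bounded_above (A d)) -> bounded_above (fun p => \sum_(d < D) c d * A d p).
Proof.
move=> bA; elim: D => [|D [N IH]]; first by exists 0 => p _; rewrite big_ord0.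
have [N' h'] := bA D; exists (Num.max N N') => p; rewrite ge_max => /andP[h1 h2].
by rewrite big_ord_recr /= IH // h' // mulr0 addr0.
Qed.

Lemma bounded_below_sum D (c : nat -> C) (A : nat -> int -> C) :
  (forall d, bounded_below (A d)) -> bounded_below (fun p => \sum_(d < D) c d * A d p).
Proof.
move=> bA; elim: D => [|D [N IH]]; first by exists 0 => p _; rewrite big_ord0.
have [N' h'] := bA D; exists (Num.min N N') => p; rewrite le_min => /andP[h1 h2].
by rewrite big_ord_recr /= IH // h' // mulr0 addr0.
Qed.

(* Multiplication by a series with invertible leading coefficient is injective on Laurent series. *)
Lemma triangular_eq0 A (k : nat -> C) : bounded_above A -> k 0%N != 0 ->
  (forall r, fsumn (fun i => k i * A (r + i%:Z)) = 0) -> forall p, A p = 0.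
Proof.
move=> bA k0 h p; have [N AN] := bA.
(* Induction on the distance of [q] below the bound [N]: all later coefficients vanish already, so
   the equation at [q] reduces to its leading term. *)
have aux (n : nat) q : N <= q + n%:Z -> A q = 0.
  elim/ltn_ind: n q => n IH q hq.
  have := h q; rewrite fsumn_recl; last exact: bounded_above_ev0.
  rewrite (_ : (fun i : nat => _) = fun _ => 0) ?fsumn0.
    by rewrite !addr0 => /eqP; rewrite mulf_eq0 (negbTE k0) /= => /eqP.
  apply: funext => i; case: n IH hq => [|n] IH hq.
    by rewrite AN ?mulr0 //; lia.
  by rewrite (IH n) ?mulr0 //; lia.
by apply: (aux `|N - p|%N); lia.
Qed.

Lemma triangular_below_eq0 A (k : nat -> C) : bounded_below A -> k 0%N != 0 ->
  (forall r, fsumn (fun i => k i * A (r - i%:Z)) = 0) -> forall p, A p = 0.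
Proof.
move=> [N AN] k0 h p; rewrite -[p]opprK.
apply: (@triangular_eq0 (fun p => A (- p)) k) => //.
  by exists (- N) => q hq; apply: AN; lia.
move=> r; rewrite -[RHS](h (- r)); apply: fsumn_eq => i.
by rewrite opprD.
Qed.

Variable z : C.

(* The coefficient of [x0 ^ (-l-1) * x1 ^ r] in the P(z)-Jacobi identity, for scalar series [A],
   [G] and [H] standing for a matrix coefficient of the three vertex operators. *)
Definition Jac A G H := forall l r : int,
  fsumn (fun i => binz l i * (- z) ^+ i * A (r - l + i%:Z))
  - (-1) ^ l * fsumn (fun i => binz l i * z ^ (l - i%:Z) * (-1) ^+ i * G (r - i%:Z))
  = fsumn (fun i => z ^ (- r - i%:Z - 1) * binz (r + i%:Z) i * (-1) ^+ i * H (- l - 1 - i%:Z)).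

(** The identity is linear in the triple; the bounds make every sum finite, so that [fsumn] commutes
    with the combination. This reduces rational functions to monomials. *)
Lemma Jac_sum D (c : nat -> C) (A G H : nat -> int -> C) :
  (forall d, [/\ bounded_above (A d), bounded_below (G d), bounded_below (H d) &
     Jac (A d) (G d) (H d)]) ->
  Jac (fun p => \sum_(d < D) c d * A d p) (fun p => \sum_(d < D) c d * G d p)
      (fun p => \sum_(d < D) c d * H d p).
Proof.
move=> J l r.
have E (f : nat -> C) (g : nat -> int) (B : nat -> int -> C) :
    (forall d, ev0 (fun i => f i * B d (g i))) ->
    fsumn (fun i => f i * \sum_(d < D) c d * B d (g i)) =
    \sum_(d < D) c d * fsumn (fun i => f i * B d (g i)).
  move=> e; rewrite (_ : (fun i => _) = fun i => \sum_(d < D) c d * (f i * B d (g i))).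
    rewrite (@fsumn_sum _ D (fun d i => c d * (f i * B d (g i)))).
      by apply: eq_bigr => d _; rewrite fsumnM.
    by move=> d _; have [N h] := e d; exists N => k /h->; rewrite mulr0.
  by apply: funext => i; rewrite mulr_sumr; apply: eq_bigr => d _; rewrite mulrCA.
rewrite !E; first last.
- by move=> d; apply: bounded_above_ev0; case: (J d).
- by move=> d; apply: bounded_below_ev0; case: (J d).
- by move=> d; apply: bounded_below_ev0; case: (J d).
rewrite mulr_sumr -sumrB; apply: eq_bigr => d _.
by have [_ _ _ /(_ l r) <-] := J d; ring.
Qed.

(* Expansion of [x ^ m * (x - z) ^ n] at infinity. *)
Definition mon_inf (m n p : int) : C := bz n (m + n - p) * (- z) ^ (m + n - p).
(* Expansion of [x ^ m * (x + c) ^ n] at 0. *)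
Definition mon0 (c : C) (m n p : int) : C := bz n (p - m) * c ^ (n - (p - m)).

Lemma mon_inf_bounded m n : bounded_above (mon_inf m n).
Proof. by exists (m + n + 1) => p h; rewrite /mon_inf bz_neg ?mul0r //; lia. Qed.

Lemma mon0_bounded c m n : bounded_below (mon0 c m n).
Proof. by exists (m - 1) => p h; rewrite /mon0 bz_neg ?mul0r //; lia. Qed.

Lemma vandermonde_ev0 l n k : ev0 (fun i => binz l i * bz n (k - i%:Z)).
Proof. by exists `|k|.+1 => i h; rewrite bz_neg ?mulr0 //; lia. Qed.

(** Negation of the upper index: it shows that the third sum in [Jac] is multiplication by
    (z+y)^(-r-1), expanded at y = 0. *)
Lemma binz_opp r i : binz (r + i%:Z) i * (-1) ^+ i = binz (- r - 1) i.
Proof.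
rewrite /Defs.binz mulrAC; congr (_ / _).
rewrite (reindex_inj rev_ord_inj) /= -[X in (-1) ^+ X]card_ord -prodr_const -big_split /=.
apply: eq_bigr => j _; rewrite natrB // !intrD rmorphN /= -!natr1.
by rewrite -pmulrn; ring.
Qed.

Hypothesis z0 : z != 0.

(** The first sum in [Jac] is the coefficient of x^r after multiplication by (x-z)^l expanded at
    infinity; on a monomial this only raises the exponent of x-z. *)
Lemma mon_infM l m n r :
  fsumn (fun i => binz l i * (- z) ^+ i * mon_inf m n (r - l + i%:Z)) =
  mon_inf m (l + n) r.
Proof.
have nz0 : - z != 0 by rewrite oppr_eq0.
rewrite /mon_inf -vandermonde mulrC -fsumnM; last exact: vandermonde_ev0.
apply: fsumn_eq => i.
rewrite (_ : m + (l + n) - r - i%:Z = m + n - (r - l + i%:Z)); last by ring.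
rewrite (_ : m + (l + n) - r = i%:Z + (m + n - (r - l + i%:Z))); last by ring.
by rewrite (expfzDr i%:Z _ nz0) -exprnP; ring.
Qed.

(** The same for the second sum, with (x-z)^l = (-1)^l (z-x)^l expanded at x = 0. *)
Lemma mon0M l m n r :
  (-1) ^ l * fsumn (fun i => binz l i * z ^ (l - i%:Z) * (-1) ^+ i * mon0 (- z) m n (r - i%:Z)) =
  mon0 (- z) m (l + n) r.
Proof.
have nz0 : - z != 0 by rewrite oppr_eq0.
have m10 : -1 != 0 :> C by rewrite oppr_eq0 oner_eq0.
rewrite /mon0 -vandermonde mulrC [RHS]mulrC -fsumnM; last exact: vandermonde_ev0.
rewrite mulrC -fsumnM; last first.
  by apply: (@bounded_below_ev0 (mon0 (- z) m n)); apply: mon0_bounded.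
apply: fsumn_eq => i.
rewrite (_ : r - m - i%:Z = r - i%:Z - m); last by ring.
rewrite (_ : l + n - (r - m) = (l - i%:Z) + (n - (r - i%:Z - m))); last by ring.
rewrite (expfzDr (l - i%:Z) _ nz0) -[in (- z) ^ (l - _)]mulN1r exprzMl ?unitfE //.
have -> : (-1 : C) ^ (l - i%:Z) = (-1) ^ l * (-1) ^+ i.
  rewrite expfzDr // -invr_expz -exprnP; congr (_ * _).
  by rewrite -exprVn invrN1.
by ring.
Qed.

(** In the variable y = x-z the third sum extracts the coefficient of y^(-l-1) after multiplication
    by x^(-r-1) = (z+y)^(-r-1). *)
Lemma mon0M_at l m n r :
  fsumn (fun i => z ^ (- r - i%:Z - 1) * binz (r + i%:Z) i * (-1) ^+ i * mon0 z n m (- l - 1 - i%:Z)) =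
  mon0 z n (m - r - 1) (- l - 1).
Proof.
rewrite /mon0 (_ : m - r - 1 = - r - 1 + m); last by ring.
rewrite -vandermonde mulrC -fsumnM; last exact: vandermonde_ev0.
apply: fsumn_eq => i; rewrite -binz_opp.
rewrite (_ : - l - 1 - n - i%:Z = - l - 1 - i%:Z - n); last by ring.
rewrite (_ : - r - 1 + m - (- l - 1 - n) = (- r - i%:Z - 1) + (m - (- l - 1 - i%:Z - n))); last by ring.
by rewrite (expfzDr (- r - i%:Z - 1) _ z0); ring.
Qed.

(** Once the multipliers are absorbed, a common power of z factors out and what remains is
    [residue_bz] for x^(m-r-1) (x-1)^(l+n). *)
Lemma Jac_mon m n : Jac (mon_inf m n) (mon0 (- z) m n) (mon0 z n m).
Proof.
move=> l r; rewrite mon_infM mon0M mon0M_at /mon_inf /mon0.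
have := residue_bz R (m - r - 1) (l + n).
rewrite (_ : m - r - 1 + (l + n) + 1 = m + (l + n) - r); last by ring.
rewrite (_ : - 1 - (m - r - 1) = r - m); last by ring.
rewrite (_ : - 1 - (l + n) = - l - 1 - n); last by ring.
move=> <-; rewrite (_ : m - r - 1 - (- l - 1 - n) = m + (l + n) - r); last by ring.
rewrite (_ : l + n - (r - m) = m + (l + n) - r); last by ring.
by rewrite -[- z]mulN1r exprzMl ?unitfE ?oppr_eq0 ?oner_eq0 //; ring.
Qed.

(** * Expansions of P(x) / (x^a (x-z)^b) at infinity, 0 and z *)

Definition expand_inf (P : {poly C}) (a b : nat) (p : int) : C :=
  \sum_(d < size P) P`_d * mon_inf (d%:Z - a%:Z) (- b%:Z) p.

Lemma iota0E (Q : {poly C}) m n c r :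
  iota0 Q m n c r = \sum_(d < size Q) Q`_d * mon0 c (d%:Z - m%:Z) (- n%:Z) r.
Proof.
apply: eq_bigr => d _; rewrite /mon0 /bz.
rewrite (_ : r - (d%:Z - m%:Z) = r + m%:Z - d%:Z); last by ring.
case: ifP => _; last by rewrite mul0r mulr0.
exact/esym/mulrA.
Qed.

Lemma coefs_widen (Q : {poly C}) (g : nat -> C) D : (size Q <= D)%N ->
  \sum_(d < D) Q`_d * g d = \sum_(d < size Q) Q`_d * g d.
Proof.
move=> h; apply: (@sum_ev0 _ (fun d => Q`_d * g d)) => // d hd.
by rewrite nth_default // mul0r.
Qed.

Lemma iota0_shift (P : {poly C}) a b r :
  iota0 (P \Po ('X + z%:P)) b a z r =
  \sum_(d < size P) P`_d * mon0 z (- b%:Z) (d%:Z - a%:Z) r.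
Proof.
have szP : size (P \Po ('X + z%:P)) = size P by rewrite size_comp_poly2 // size_XaddC.
rewrite iota0E szP comp_polyE.
under eq_bigr do rewrite coef_sum mulr_suml.
rewrite exchange_big; apply: eq_bigr => d _ /=.
under eq_bigr do rewrite coefZ -mulrA.
rewrite -mulr_sumr; congr (_ * _).
have szX : size (('X + z%:P) ^+ d) = d.+1.
  by rewrite -(opprK z%:P) -polyCN size_exp_XsubC.
pose g (j : nat) := mon0 z (j%:Z - b%:Z) (- a%:Z) r.
rewrite (coefs_widen g); last by rewrite szX.
rewrite -(coefs_widen g (D := d.+1)) ?szX //.
have := vandermonde R d%:Z (- a%:Z) (r + b%:Z).
rewrite (fsumnE (N := d.+1)); last by move=> i h; rewrite binz_natE bin_small // mul0r.
rewrite /g /mon0 opprK => <-; rewrite mulr_suml; apply: eq_bigr => i _.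
rewrite binz_natE addrC exprDn coef_sum.
rewrite (bigD1 i) //= big1 ?addr0; last first.
  move=> j ji; rewrite -rmorphXn /= coefMn coefCM coefXn.
  by rewrite (_ : (i == j :> nat) = false) ?mulr0 ?mul0rn // eq_sym; apply/negbTE.
rewrite -rmorphXn /= coefMn coefCM coefXn eqxx mulr1.
rewrite (_ : r - (i%:Z - b%:Z) = r + b%:Z - i%:Z); last by ring.
rewrite (_ : d%:Z - a%:Z - (r + b%:Z) = (d - i)%N%:Z + (- a%:Z - (r + b%:Z - i%:Z))); last first.
  by rewrite -subzn ?[LHS]addrA; [ring | rewrite -ltnS].
by rewrite (expfzDr (d - i)%N%:Z _ z0) -exprnP -mulr_natr; ring.
Qed.

Definition expand_0 (P : {poly C}) (a b : nat) (p : int) : C := iota0 P a b (- z) p.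
(** In the variable x-z the pole at z sits at 0 and the pole at 0 sits at -z, hence the exchange of
    [a] and [b]. *)
Definition expand_z (P : {poly C}) (a b : nat) (p : int) : C := iota0 (P \Po ('X + z%:P)) b a z p.

Lemma Jac_expand P a b : Jac (expand_inf P a b) (expand_0 P a b) (expand_z P a b).
Proof.
pose A d := mon_inf (d%:Z - a%:Z) (- b%:Z).
pose G d := mon0 (- z) (d%:Z - a%:Z) (- b%:Z).
pose H d := mon0 z (- b%:Z) (d%:Z - a%:Z).
have -> : expand_0 P a b = fun p => \sum_(d < size P) P`_d * G d p.
  by apply: funext => p; rewrite /expand_0 iota0E.
have -> : expand_z P a b = fun p => \sum_(d < size P) P`_d * H d p.
  by apply: funext => p; rewrite /expand_z iota0_shift.
apply: (@Jac_sum _ (fun d => P`_d) A G H) => d; split.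
- exact: mon_inf_bounded.
- exact: mon0_bounded.
- exact: mon0_bounded.
- exact: Jac_mon.
Qed.

Lemma expand_inf_bounded P a b : bounded_above (expand_inf P a b).
Proof.
apply: (@bounded_above_sum _ (fun d => P`_d) (fun d => mon_inf (d%:Z - a%:Z) (- b%:Z))) => d.
exact: mon_inf_bounded.
Qed.

Lemma iota0_bounded (P : {poly C}) a b c : bounded_below (iota0 P a b c).
Proof.
have -> : iota0 P a b c = fun p => \sum_(d < size P) P`_d * mon0 c (d%:Z - a%:Z) (- b%:Z) p.
  by apply: funext => p; rewrite iota0E.
apply: (@bounded_below_sum _ (fun d => P`_d) (fun d => mon0 c (d%:Z - a%:Z) (- b%:Z))) => d.
exact: mon0_bounded.
Qed.

(** At r = -1 the binomials of the third sum vanish except for i = 0, so [H] can be read off from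
    [A] and [G]. *)
Lemma Jac_at A G H l : bounded_below H -> Jac A G H ->
  H (- l - 1) = fsumn (fun i => binz l i * (- z) ^+ i * A (- 1 - l + i%:Z))
  - (-1) ^ l * fsumn (fun i => binz l i * z ^ (l - i%:Z) * (-1) ^+ i * G (- 1 - i%:Z)).
Proof.
move=> bH ->; rewrite fsumn_recl; last exact: bounded_below_ev0.
rewrite (_ : (fun i : nat => _) = fun _ => 0) ?fsumn0 ?addr0.
  by rewrite opprK subrr expr0z binz0 !mul1r.
apply: funext => i; rewrite (_ : -1 + i.+1%:Z = i); last by lia.
by rewrite binz_natE bin_small // mulr0 !mul0r.
Qed.

(** For large [l] the third sums vanish, so (x-z)^l [G] and (x-z)^l [G'] both have the coefficients
    of (x-z)^l [A]. At 0 the factor has an invertible leading coefficient, which gives [G = G'];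
    then [Jac_at] determines [H]. *)
Lemma Jac_unique A G H G' H' :
  bounded_below G -> bounded_below H -> bounded_below G' -> bounded_below H' ->
  Jac A G H -> Jac A G' H' -> G = G' /\ H = H'.
Proof.
move=> bG bH bG' bH' J J'.
have GG : G = G'.
  have [N HN] := bH; have [N' HN'] := bH'.
  (* This [l] is nonnegative and puts every index -l-1-i below both bounds [N] and [N']. *)
  pose l : int := `|N|%:Z + `|N'|%:Z.
  have m1l : (-1 : C) ^ l != 0 by rewrite expfz_neq0 // oppr_eq0 oner_eq0.
  have E r : fsumn (fun i => binz l i * z ^ (l - i%:Z) * (-1) ^+ i * G (r - i%:Z)) =
             fsumn (fun i => binz l i * z ^ (l - i%:Z) * (-1) ^+ i * G' (r - i%:Z)).
    apply: (mulfI m1l); have := J l r; have := J' l r.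
    rewrite [in RHS](_ : (fun i : nat => _) = fun _ => 0) ?fsumn0; last first.
      by apply: funext => i; rewrite HN' ?mulr0 // /l; lia.
    move=> /eqP; rewrite subr_eq0 => /eqP <-.
    rewrite [in RHS](_ : (fun i : nat => _) = fun _ => 0) ?fsumn0; last first.
      by apply: funext => i; rewrite HN ?mulr0 // /l; lia.
    by move=> /eqP; rewrite subr_eq0 => /eqP <-.
  apply: funext => p; apply/eqP; rewrite -subr_eq0; apply/eqP.
  apply: (@triangular_below_eq0 (fun p => G p - G' p) (fun i => binz l i * z ^ (l - i%:Z) * (-1) ^+ i)).
  - have [M GM] := bG; have [M' GM'] := bG'; exists (Num.min M M') => q.
    by rewrite le_min => /andP[h1 h2]; rewrite GM // GM' // subrr.
  - by rewrite binz0 mul1r subr0 mulr1 expfz_neq0.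
  move=> r; rewrite (_ : (fun i => _) = fun i =>
    binz l i * z ^ (l - i%:Z) * (-1) ^+ i * G (r - i%:Z) -
    binz l i * z ^ (l - i%:Z) * (-1) ^+ i * G' (r - i%:Z)); last by apply: funext => i; rewrite mulrBr.
  rewrite fsumnB; [by rewrite E subrr| exact: bounded_below_ev0 | exact: bounded_below_ev0].
split => //; apply: funext => p; rewrite (_ : p = - (- p - 1) - 1); last by ring.
by rewrite (Jac_at _ bH J) (Jac_at _ bH' J') GG.
Qed.

(** Clearing the pole at z leaves a series bounded on both sides, hence a Laurent polynomial x^(-a)
    P; [triangular_eq0] divides by (x-z)^b again. The pole orders come only from the supports of [G]
    and [H]. *)
Lemma Jac_rational A G H (a b : nat) : bounded_above A ->
  (forall p, p < - a%:Z -> G p = 0) -> (forall p, p < - b%:Z -> H p = 0) ->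
  Jac A G H -> exists P, A = expand_inf P a b.
Proof.
move=> bA G0 H0 J; have [N AN] := bA.
(* [c r] is the coefficient of x^r in (x-z)^b [A]; for [l = b] the third term of the identity is
   zero. *)
pose c r := fsumn (fun i => binz b i * (- z) ^+ i * A (r - b%:Z + i%:Z)).
have c_low r : r < - a%:Z -> c r = 0.
  move=> h; have := J b r.
  rewrite [in RHS](_ : (fun i : nat => _) = fun _ => 0) ?fsumn0; last first.
    by apply: funext => i; rewrite H0 ?mulr0 //; lia.
  rewrite [X in _ * fsumn X](_ : _ = fun _ => 0) ?fsumn0 ?mulr0 ?subr0 //.
  by apply: funext => i; rewrite G0 ?mulr0 //; lia.
have c_high r : N + b%:Z <= r -> c r = 0.
  move=> h; rewrite /c (_ : (fun i : nat => _) = fun _ => 0) ?fsumn0 //.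
  by apply: funext => i; rewrite AN ?mulr0 //; lia.
(* [c] vanishes from N+b on, so after the shift by [a] no degree at or above N+b+a survives. *)
pose K := absz (N + b%:Z + a%:Z); pose P := \poly_(d < K) c (d%:Z - a%:Z); exists P.
have cP d : P`_d = c (d%:Z - a%:Z).
  rewrite coef_poly; case: ltnP => // h; rewrite c_high //.
  by rewrite /K in h; lia.
have E r : fsumn (fun i => binz b i * (- z) ^+ i * expand_inf P a b (r - b%:Z + i%:Z)) = c r.
  rewrite (_ : (fun i => _) = fun i => \sum_(d < size P)
     P`_d * (binz b i * (- z) ^+ i * mon_inf (d%:Z - a%:Z) (- b%:Z) (r - b%:Z + i%:Z))); last first.
    by apply: funext => i; rewrite mulr_sumr; apply: eq_bigr => d _; rewrite mulrCA.
  have ev d : ev0 (fun i => binz b i * (- z) ^+ i * mon_inf (d%:Z - a%:Z) (- b%:Z) (r - b%:Z + i%:Z)).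
    by apply: bounded_above_ev0; apply: mon_inf_bounded.
  rewrite (@fsumn_sum _ (size P) (fun d i =>
     P`_d * (binz b i * (- z) ^+ i * mon_inf (d%:Z - a%:Z) (- b%:Z) (r - b%:Z + i%:Z)))); last first.
    by move=> d _; have [M h] := ev d; exists M => k /h ->; rewrite mulr0.
  under eq_bigr => d _ do rewrite fsumnM // mon_infM subrr /mon_inf bz0l addr0.
  have [h|h] := ltP r (- a%:Z).
    rewrite c_low // big1 // => d _.
    rewrite (_ : (_ == 0) = false) ?mul0r ?mulr0 //.
    by apply/negbTE/eqP => e; lia.
  have [k kE] : exists k : nat, r = k%:Z - a%:Z by exists (absz (r + a%:Z)); lia.
  pose g (d : nat) : C := (d%:Z - a%:Z - (k%:Z - a%:Z) == 0)%:R * (- z) ^ (d%:Z - a%:Z - (k%:Z - a%:Z)).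
  (* The range is enlarged to contain the index [k] even when [k] exceeds the degree of [P]. *)
  rewrite kE -(coefs_widen g (leq_addr k.+1 _)) /g.
  have dr : (k < size P + k.+1)%N by lia.
  rewrite (bigD1 (Ordinal dr)) //= big1 ?addr0.
    by rewrite cP subrr eqxx expr0z !mulr1.
  move=> d; rewrite -val_eqE /= => hd.
  rewrite (_ : d%:Z - a%:Z - (k%:Z - a%:Z) = d%:Z - k%:Z); last by ring.
  by rewrite subr_eq0 eqz_nat (negbTE hd) mul0r mulr0.
apply: funext => p; apply/eqP; rewrite -subr_eq0; apply/eqP.
apply: (@triangular_eq0 (fun p => A p - expand_inf P a b p) (fun i => binz b i * (- z) ^+ i)).
- have [M hM] := expand_inf_bounded P a b; exists (Num.max N M) => q.
  by rewrite ge_max => /andP[h1 h2]; rewrite AN // hM // subrr.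
- by rewrite binz0 mul1r oner_eq0.
move=> r; rewrite (_ : (fun i => _) = fun i =>
    binz b i * (- z) ^+ i * A (r + b%:Z - b%:Z + i%:Z) -
    binz b i * (- z) ^+ i * expand_inf P a b (r + b%:Z - b%:Z + i%:Z)); last first.
  by apply: funext => i; rewrite mulrBr addrK.
rewrite fsumnB; [by rewrite E /c subrr| exact: bounded_above_ev0 | apply: bounded_above_ev0].
exact: expand_inf_bounded.
Qed.
End Residues.

(** * Convergence of expansions at infinity *)

Section Convergence.
Variable R : realType.
Local Notation C := R[i].
Local Notation binz := (@binz R).
Local Notation bz := (@bz R).
Implicit Types (x y z c L : C) (a : nat -> C).

Lemma normC0 : normC (0 : C) = 0.
Proof. exact: ComplexField.Normc.normc0. Qed.
Lemma normCM x y : normC (x * y) = normC x * normC y.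
Proof. exact: ComplexField.Normc.normcM. Qed.
Lemma normCV x : normC x^-1 = (normC x)^-1.
Proof. exact: ComplexField.Normc.normcV. Qed.
Lemma normC1 : normC (1 : C) = 1.
Proof. exact: ComplexField.Normc.normc1. Qed.
Lemma normC_ge0 x : 0 <= normC x.
Proof. by case: x => u v; rewrite /normC /= sqrtr_ge0. Qed.
Lemma normCN x : normC (- x) = normC x.
Proof. by case: x => u v; rewrite /normC /= !sqrrN. Qed.
Lemma normCD x y : normC (x + y) <= normC x + normC y.
Proof. exact: le_normcD. Qed.
Lemma normC_eq0 x : (normC x == 0) = (x == 0).
Proof. by apply/eqP/eqP => [/ComplexField.Normc.eq0_normc|->]; rewrite ?normC0. Qed.
Lemma normC_gt0 x : (0 < normC x) = (x != 0).
Proof. by rewrite lt_neqAle normC_ge0 andbT eq_sym normC_eq0. Qed.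
Lemma normCX x n : normC (x ^+ n) = normC x ^+ n.
Proof. by elim: n => [|n IH]; rewrite ?expr0 ?normC1 // !exprS normCM IH. Qed.
Lemma normC_nat n : normC (n%:R : C) = n%:R.
Proof.
by rewrite /normC -[n%:R](rmorph_nat (real_complex R)) /= expr0n addr0 sqrtr_sqr ger0_norm.
Qed.
Lemma normC_sum n (f : nat -> C) : normC (\sum_(k < n) f k) <= \sum_(k < n) normC (f k).
Proof.
elim: n => [|n IH]; first by rewrite !big_ord0 normC0.
by rewrite !big_ord_recr /=; apply: le_trans (normCD _ _) _; rewrite lerD2r.
Qed.

Lemma cvgC_cst L : cvgC (fun _ => L) L.
Proof. by move=> e e0; exists 0%N => n _; rewrite subrr normC0. Qed.

Lemma cvgC_ext (s s' : nat -> C) L : (forall n, s n = s' n) -> cvgC s L -> cvgC s' L.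
Proof. by move=> /funext->. Qed.

Lemma cvgCD (s s' : nat -> C) L L' :
  cvgC s L -> cvgC s' L' -> cvgC (fun n => s n + s' n) (L + L').
Proof.
move=> h h' e e0; have e2 : 0 < e / 2 by lra.
have [N hN] := h _ e2; have [N' hN'] := h' _ e2.
exists (maxn N N') => n; rewrite geq_max => /andP[/hN lt1 /hN' lt2].
rewrite opprD addrACA; apply: le_lt_trans (normCD _ _) _; lra.
Qed.

Lemma cvgCM c (s : nat -> C) L : cvgC s L -> cvgC (fun n => c * s n) (c * L).
Proof.
move=> h e e0; have c1 : 0 < normC c + 1 by have := normC_ge0 c; lra.
have [N hN] := h _ (divr_gt0 e0 c1); exists N => n /hN lt.
rewrite -mulrBr normCM; have := normC_ge0 c; have := normC_ge0 (s n - L).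
have : normC (s n - L) * (normC c + 1) < e by rewrite -ltr_pdivlMr.
nra.
Qed.

Lemma cvgC_unique (s : nat -> C) L L' : cvgC s L -> cvgC s L' -> L = L'.
Proof.
move=> h h'; apply/eqP; rewrite -subr_eq0 -normC_eq0; apply/negP => /negP n0.
have d0 : 0 < normC (L - L') by rewrite lt_neqAle eq_sym n0 normC_ge0.
have e2 : 0 < normC (L - L') / 2 by lra.
have [N hN] := h _ e2; have [N' hN'] := h' _ e2.
have := hN _ (leq_maxl N N'); have := hN' _ (leq_maxr N N'); set m := maxn _ _ => h1 h2.
have := normCD (s m - L') (- (s m - L)).
rewrite (_ : s m - L' + - (s m - L) = L - L'); last by ring.
by rewrite normCN; lra.
Qed.

Lemma cvgC_shift (s : nat -> C) L : cvgC s L <-> cvgC (fun n => s n.+1) L.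
Proof.
split=> h e /h [N hN]; first by exists N => n h1; apply/hN/leqW.
by exists N.+1 => -[//|n] h1; apply: hN.
Qed.

Lemma sums_to_shift a L : sums_to a (a 0%N + L) <-> sums_to (fun k => a k.+1) L.
Proof.
rewrite /sums_to; split => h.
  move/cvgC_shift: h => /(cvgCD (cvgC_cst (- a 0%N))); rewrite addKr.
  by apply: cvgC_ext => n; rewrite big_ord_recl addKr.
apply/cvgC_shift; apply: cvgC_ext (cvgCD (cvgC_cst (a 0%N)) h) => n.
by rewrite big_ord_recl.
Qed.

Lemma sums_toD a a' L L' : sums_to a L -> sums_to a' L' -> sums_to (fun k => a k + a' k) (L + L').
Proof. by move=> h h'; apply: cvgC_ext (cvgCD h h') => n; rewrite big_split. Qed.

Lemma sums_toM c a L : sums_to a L -> sums_to (fun k => c * a k) (c * L).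
Proof. by move=> h; apply: cvgC_ext (cvgCM c h) => n; rewrite mulr_sumr. Qed.

Lemma sums_to0 : sums_to (fun _ => 0 : C) 0.
Proof. by apply: cvgC_ext (cvgC_cst 0) => n; rewrite big1. Qed.

(** The partial sums of norms are nondecreasing, so boundedness suffices, with their supremum as
    limit. *)
Lemma abs_summableP a :
  abs_summable a <-> exists B : R, forall n, \sum_(k < n) normC (a k) <= B.
Proof.
pose T n := \sum_(k < n) normC (a k).
have Tmono m n : (m <= n)%N -> T m <= T n.
  move=> /subnKC <-; rewrite /T big_split_ord lerDl /=.
  by apply: sumr_ge0 => k _; apply: normC_ge0.
split=> [[S hS]|[B hB]].
  have [N hN] := hS 1 ltr01; exists (S + 1) => n.
  have := hN _ (leq_maxl N n); rewrite ltr_norml => /andP[_ h].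
  by have := Tmono _ _ (leq_maxr N n); rewrite /T; lra.
pose E : set R := range T; exists (sup E) => e e0.
have supE : has_sup E.
  by split; [exists (T 0%N); exists 0%N | exists B => _ [n _ <-]; apply: hB].
have [_ [N _ <-] h] := sup_adherent e0 supE.
exists N => n /Tmono h1; rewrite -/(T n).
have : T n <= sup E by apply: sup_upper_bound => //; exists n.
by move=> h2; rewrite ltr_norml; apply/andP; split; lra.
Qed.

Lemma abs_summable_shift a : abs_summable a <-> abs_summable (fun k => a k.+1).
Proof.
split=> /abs_summableP[B hB]; apply/abs_summableP.
  exists B => n; apply: le_trans (hB n.+1).
  by rewrite big_ord_recl lerDr normC_ge0.
exists (normC (a 0%N) + B) => -[|n].
  rewrite big_ord0 addr_ge0 ?normC_ge0 //.
  by apply: le_trans (hB 0%N); rewrite big_ord0.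
by rewrite big_ord_recl lerD2l; apply: hB.
Qed.

Lemma abs_summableD a a' : abs_summable a -> abs_summable a' ->
  abs_summable (fun k => a k + a' k).
Proof.
move=> /abs_summableP[B hB] /abs_summableP[B' hB']; apply/abs_summableP; exists (B + B') => n.
apply: le_trans (lerD (hB n) (hB' n)); rewrite -big_split /=.
by apply: ler_sum => k _; apply: normCD.
Qed.

Lemma abs_summableM c a : abs_summable a -> abs_summable (fun k => c * a k).
Proof.
move=> /abs_summableP[B hB]; apply/abs_summableP; exists (normC c * B) => n.
under eq_bigr do rewrite normCM.
by rewrite -mulr_sumr ler_wpM2l ?normC_ge0.
Qed.

Lemma abs_summable0 : abs_summable (fun _ => 0 : C).
Proof. by apply/abs_summableP; exists 0 => n; rewrite big1 // => k _; rewrite normC0. Qed.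

Lemma abs_summable_cvg0 a : abs_summable a -> cvgC a 0.
Proof.
move=> [S hS] e e0; have e2 : 0 < e / 2 by lra.
have [N hN] := hS _ e2; exists N => n h; rewrite subr0.
have := hN _ h; have := hN _ (leqW h); rewrite big_ord_recr /= !ltr_norml.
move=> /andP[h1 h2] /andP[h3 h4]; lra.
Qed.

(** The shift moves the single term [c 0] from the nonnegative half to the negative half. *)
Lemma abs_conv_Z_shift1 (c : int -> C) L :
  abs_conv_Z c L <-> abs_conv_Z (fun p => c (p + 1)) L.
Proof.
have pE k : (Posz k + 1 : int) = k.+1 by rewrite -PoszD addn1.
have nE k : (Negz k.+1 + 1 : int) = Negz k by lia.
have E1 : (fun k => c (Posz k + 1)) = fun k => c k.+1 by apply: funext => k; rewrite pE.
have E2 : (fun k => c (Negz k.+1 + 1)) = fun k => c (Negz k) by apply: funext => k; rewrite nE.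
have c0 : c (Negz 0 + 1) = c 0 by [].
split=> -[s1 s2 [L1 [L2 [h1 h2 ->]]]]; split.
- by rewrite E1; apply/(abs_summable_shift (fun k => c k)).
- by apply/abs_summable_shift; rewrite E2.
- exists (L1 - c 0), (c 0 + L2); split; last by ring.
    rewrite E1; apply/(@sums_to_shift (fun k => c (Posz k))).
    by rewrite addrC subrK.
  by rewrite -c0; apply/(@sums_to_shift (fun k => c (Negz k + 1))); rewrite E2.
- by apply/(abs_summable_shift (fun k => c (Posz k))); rewrite -E1.
- by move/abs_summable_shift: s2; rewrite E2.
- exists (c 0 + L1), (L2 - c 0); split; last by ring.
    by apply/(@sums_to_shift (fun k => c (Posz k))); rewrite -E1.
  rewrite -E2; apply/(@sums_to_shift (fun k => c (Negz k + 1))).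
  by rewrite c0 addrC subrK.
Qed.

Lemma abs_conv_Z_shift (c : int -> C) L s :
  abs_conv_Z c L <-> abs_conv_Z (fun p => c (p + s)) L.
Proof.
have E k : (fun p => c (p + 1 + k)) = fun p => c (p + (k + 1)).
  by apply: funext => p; rewrite -addrA (addrC 1).
elim/int_ind_step: s => [|s IH|s IH].
- by rewrite (_ : (fun p => _) = c) //; apply: funext => p; rewrite addr0.
- by apply: (iff_trans IH); rewrite -E; exact: (abs_conv_Z_shift1 (fun p => c (p + s))).
- by apply: (iff_trans IH); rewrite -E; apply: iff_sym; exact: (abs_conv_Z_shift1 (fun p => c (p + s))).
Qed.

Lemma abs_conv_Z0 : abs_conv_Z (fun _ => 0 : C) 0.
Proof.
split; [exact: abs_summable0 | exact: abs_summable0 |].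
by exists 0, 0; split; [exact: sums_to0 | exact: sums_to0 | rewrite addr0].
Qed.

Lemma abs_conv_ZD (c c' : int -> C) L L' : abs_conv_Z c L -> abs_conv_Z c' L' ->
  abs_conv_Z (fun p => c p + c' p) (L + L').
Proof.
move=> [s1 s2 [L1 [L2 [h1 h2 ->]]]] [s1' s2' [L1' [L2' [h1' h2' ->]]]].
split; [exact: abs_summableD | exact: abs_summableD |].
by exists (L1 + L1'), (L2 + L2'); split; [exact: sums_toD | exact: sums_toD | ring].
Qed.

Lemma abs_conv_ZM x (c : int -> C) L : abs_conv_Z c L -> abs_conv_Z (fun p => x * c p) (x * L).
Proof.
move=> [s1 s2 [L1 [L2 [h1 h2 ->]]]].
split; [exact: abs_summableM | exact: abs_summableM |].
by exists (x * L1), (x * L2); split; [exact: sums_toM | exact: sums_toM | ring].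
Qed.

Lemma abs_conv_Z_sum D (c : nat -> int -> C) (L : nat -> C) : (forall d, abs_conv_Z (c d) (L d)) ->
  abs_conv_Z (fun p => \sum_(d < D) c d p) (\sum_(d < D) L d).
Proof.
move=> h; elim: D => [|D IH].
  rewrite big_ord0 (_ : (fun p => _) = fun _ => 0); first exact: abs_conv_Z0.
  by apply: funext => p; rewrite big_ord0.
rewrite big_ord_recr /= (_ : (fun p => _) = fun p => \sum_(d < D) c d p + c D p).
  exact: abs_conv_ZD.
by apply: funext => p; rewrite big_ord_recr.
Qed.

(** Shifting by q+1 places the whole support in the negative half, so a two-sided sum becomes an
    ordinary series running down from [q]. *)
Lemma abs_conv_Z_above (c : int -> C) (q : int) L : (forall p, q < p -> c p = 0) ->
  abs_conv_Z c L <-> abs_summable (fun k => c (q - k%:Z)) /\ sums_to (fun k => c (q - k%:Z)) L.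
Proof.
move=> c0; apply: (iff_trans (abs_conv_Z_shift c L (q + 1))).
have -> : (fun k : nat => c (q - k%:Z)) = fun k => c (Negz k + (q + 1)).
  by apply: funext => k; congr c; lia.
have P0 : (fun k : nat => c (Posz k + (q + 1))) = fun _ => 0.
  by apply: funext => k; apply: c0; lia.
rewrite /abs_conv_Z P0; split=> [[_ s2 [L1 [L2 [h1 h2 ->]]]]|[s h]].
  by rewrite (cvgC_unique h1 sums_to0) add0r.
split; [exact: abs_summable0 | by [] |].
by exists 0, L; split; [exact: sums_to0 | by [] | rewrite add0r].
Qed.

(** The coefficient of t^k in (1-t)^(-b). The truncated predecessor also gives the right values 1,
    0, 0, ... for b = 0. *)
Definition negbin (b k : nat) : nat := 'C((b + k).-1, k).

Lemma negbinS b k : negbin b.+1 k.+1 = (negbin b k.+1 + negbin b.+1 k)%N.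
Proof. by rewrite /negbin !addSn !addnS /= binS. Qed.

Lemma negbinE b k : binz (- b%:Z) k = (-1) ^+ k * (negbin b k)%:R.
Proof.
elim: b k => [|b IH] k.
  rewrite oppr0 -bz_nat bz0l /negbin add0n; case: k => [|k]; first by rewrite mul1r.
  by rewrite bin_small ?mulr0.
elim: k => [|k IHk]; first by rewrite binz0 /negbin bin0 mul1r.
have := binz_pascal R (- (b.+1)%:Z) k.
rewrite (_ : - b.+1%:Z + 1 = - b%:Z); last by lia.
rewrite IH IHk => /(canLR (addrK _)) <-.
by rewrite negbinS natrD exprS; ring.
Qed.

(** Partial sums of (1-t)^(-b-1) = (1-t)^(-b) + t (1-t)^(-b-1), over any commutative ring so as to
    serve both the real bound and the complex limit. *)
Lemma negbin_rec b n (S : comNzRingType) (t : S) :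
  \sum_(k < n.+1) (negbin b.+1 k)%:R * t ^+ k =
  \sum_(k < n.+1) (negbin b k)%:R * t ^+ k + t * \sum_(k < n) (negbin b.+1 k)%:R * t ^+ k.
Proof.
rewrite big_ord_recl [X in _ = X + _]big_ord_recl {1 3}/negbin !bin0 -addrA; congr (_ + _).
rewrite mulr_sumr -big_split /=; apply: eq_bigr => k _.
by rewrite /bump /= ?add1n negbinS natrD exprS; ring.
Qed.

Lemma negbin_bound b (t : R) n : 0 <= t -> t < 1 ->
  \sum_(k < n) (negbin b k)%:R * t ^+ k <= ((1 - t) ^+ b)^-1.
Proof.
move=> t0 t1; have t1' : 0 < 1 - t by lra.
elim: b n => [|b IH] n.
  rewrite expr0 invr1; case: n => [|n]; first by rewrite big_ord0.
  rewrite big_ord_recl big1 ?addr0 /negbin ?bin0 ?mul1r // => k _.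
  by rewrite /bump /= ?add1n add0n /= bin_small ?mul0r.
have h : (1 - t) * \sum_(k < n) (negbin b.+1 k)%:R * t ^+ k <= ((1 - t) ^+ b)^-1.
  apply: le_trans (IH n.+1); have := negbin_rec b n t.
  rewrite big_ord_recr /=; set s := \sum_(k < n) _; set s' := \sum_(k < n.+1) _.
  have : 0 <= (negbin b.+1 n)%:R * t ^+ n by rewrite mulr_ge0 // exprn_ge0.
  lra.
by rewrite exprS invfM -ler_pdivlMl ?invrK in h *.
Qed.

Lemma negbin_summable b x : normC x < 1 -> abs_summable (fun k => (negbin b k)%:R * x ^+ k).
Proof.
move=> x1; apply/abs_summableP; exists ((1 - normC x) ^+ b)^-1 => n.
under eq_bigr do rewrite normCM normCX normC_nat.
by apply: negbin_bound => //; apply: normC_ge0.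
Qed.

Lemma negbin_sums b x : normC x < 1 ->
  sums_to (fun k => (negbin b k)%:R * x ^+ k) ((1 - x) ^- b).
Proof.
move=> x1; have nx : 1 - x != 0.
  by apply: contraTneq x1 => /eqP; rewrite subr_eq0 => /eqP <-; rewrite normC1 ltxx.
elim: b => [|b IH].
  rewrite expr0 invr1 -[X in sums_to _ X]addr0.
  have -> : 1 + 0 = (negbin 0 0)%:R * x ^+ 0 + 0 by rewrite /negbin bin0 mul1r.
  apply/(@sums_to_shift (fun k => (negbin 0 k)%:R * x ^+ k)).
  have -> : (fun k => (negbin 0 k.+1)%:R * x ^+ k.+1) = fun _ => 0.
    by apply: funext => k; rewrite /negbin bin_small ?mul0r.
  exact: sums_to0.
(* By [negbin_rec], (1-x) times the partial sum for b+1 is the one for b minus x times its own last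
   term, which tends to 0 by summability. *)
apply/cvgC_shift; have := cvgCM (1 - x)^-1 (cvgCD ((cvgC_shift _ _).1 IH)
   (cvgCM (- x) (abs_summable_cvg0 (negbin_summable b.+1 x1)))).
rewrite mulr0 addr0 exprS invfM; apply: cvgC_ext => n /=.
apply: (mulfI nx); rewrite mulVKf //.
have := negbin_rec b n x; rewrite big_ord_recr /= => h.
rewrite mulrBl mul1r {1}h; ring.
Qed.

Lemma sums_to_bounded a L : sums_to a L -> exists M : R, 0 <= M /\ forall k, normC (a k) <= M.
Proof.
move=> h; have [N hN] := h 1 ltr01.
pose M := \sum_(k < N) normC (a k).
have M0 n : 0 <= \sum_(k < n) normC (a k) by apply: sumr_ge0 => k _; apply: normC_ge0.
exists (M + 2); split; first by have := M0 N; rewrite /M; lra.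
move=> k; have [lt|le] := ltnP k N.
  by rewrite /M (bigD1 (Ordinal lt)) //= -addrA lerDl addr_ge0 // sumr_ge0 // => j _; apply: normC_ge0.
have := hN _ le; have := hN _ (leqW le); rewrite big_ord_recr /=.
set s := \sum_(j < k) _ => h1 h2.
have := normCD (s + a k - L) (- (s - L)).
rewrite (_ : s + a k - L + - (s - L) = a k); last by ring.
by rewrite normCN; have := M0 N; rewrite /M; lra.
Qed.

Lemma sum_expr_le (t : R) n : 0 <= t -> t <= 2^-1 -> \sum_(k < n) t ^+ k <= 2.
Proof.
move=> t0 t1; suff: \sum_(k < n) t ^+ k <= 2 - 2 * t ^+ n by have := exprn_ge0 n t0; lra.
elim: n => [|n IH]; first by rewrite big_ord0 expr0; lra.
by rewrite big_ord_recr /= exprS; have := ler_wpM2r (exprn_ge0 n t0) t1; lra.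
Qed.

(** Near 0 the constant term dominates the tail, so it must vanish; dividing by y then exposes the
    next coefficient. The point y = 0 is excluded because y stands for 1/x. *)
Lemma power_series_eq0 (e : nat -> C) (rho : R) : 0 < rho ->
  (forall y, y != 0 -> normC y < rho -> sums_to (fun k => e k * y ^+ k) 0) -> forall k, e k = 0.
Proof.
move=> rho0 h; suff e0 (f : nat -> C) :
    (forall y, y != 0 -> normC y < rho -> sums_to (fun k => f k * y ^+ k) 0) -> f 0%N = 0.
  move=> k; elim: k e h => [|k IH] e h; first exact: e0.
  apply: (IH (fun k => e k.+1)) => y y0 yr.
  have := h y y0 yr; rewrite -[X in sums_to _ X](_ : e 0%N * y ^+ 0 + 0 = 0); last first.
    by rewrite (e0 e h) mul0r addr0.
  move=> /(sums_to_shift (fun k => e k * y ^+ k)) /(sums_toM y^-1).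
  rewrite mulr0 (_ : (fun k => _) = fun k => e k.+1 * y ^+ k) //.
  by apply: funext => j; rewrite exprS; field.
move=> {}h; apply/eqP; rewrite -normC_eq0; apply/negP => /negP f0.
have f1 : 0 < normC (f 0%N) by rewrite lt_neqAle eq_sym f0 normC_ge0.
pose y0 : C := (rho / 2)%:C%C.
have rE (u : R) : 0 <= u -> normC (u%:C%C : C) = u.
  by move=> u0; rewrite /normC /= expr0n addr0 sqrtr_sqr ger0_norm.
have ny0 : normC y0 = rho / 2 by apply: rE; lra.
have y00 : y0 != 0 by rewrite -normC_gt0 ny0; lra.
have y0r : normC y0 < rho by rewrite ny0; lra.
have [M [M0 hM]] := sums_to_bounded (h y0 y00 y0r).
(* The bound 1/2 keeps the geometric sum at most 2; the other bound makes the tail, at most 2Mt, no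
   larger than a quarter of |f 0|. With |f 0 + s| < |f 0| / 2 this is contradictory. *)
pose t : R := Num.min 2^-1 (normC (f 0%N) / (8 * (M + 1))).
have t0 : 0 < t by rewrite lt_min invr_gt0 ltr0n divr_gt0 //; lra.
have t12 : t <= 2^-1 by rewrite ge_min lexx.
have tM : t * (8 * (M + 1)) <= normC (f 0%N).
  by rewrite -ler_pdivlMr ?ge_min ?lexx ?orbT //; lra.
pose y : C := y0 * t%:C%C.
have ny : normC y = normC y0 * t by rewrite normCM rE // ltW.
have ynz : y != 0 by rewrite -normC_gt0 ny mulr_gt0 // normC_gt0.
have yr : normC y < rho by rewrite ny ny0; have := ler_wpM2l (ltW rho0) t12; lra.
have e2 : 0 < normC (f 0%N) / 2 by lra.
have [N hN] := h y ynz yr _ e2; have := hN N.+1 (leqW (leqnn N)).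
rewrite subr0 big_ord_recl expr0 mulr1; set s := \sum_(k < N) _ => h1.
have hs : normC s <= M * (t * 2).
  apply: le_trans (normC_sum N (fun k => f k.+1 * y ^+ k.+1)) _.
  apply: le_trans (_ : \sum_(k < N) M * (t * t ^+ k) <= _).
    apply: ler_sum => k _; rewrite /y exprMn [f _ * _]mulrA normCM normCX rE ?(ltW t0) // -exprS.
    by apply: ler_wpM2r; [rewrite exprn_ge0 ?ltW | exact: hM].
  rewrite -!mulr_sumr; apply: (ler_wpM2l M0); apply: (ler_wpM2l (ltW t0)).
  by apply: sum_expr_le => //; apply: ltW.
have := normCD (f 0%N + s) (- s); rewrite addrK normCN.
nra.
Qed.

Variable z : C.
Hypothesis z0 : z != 0.

(** x^m (x-z)^(-b) = x^(m-b) (1-z/x)^(-b), and the negative binomial series converges absolutely at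
    z/x. *)
Lemma mon_inf_conv m b x : normC z < normC x ->
  abs_conv_Z (fun p => mon_inf z m (- b%:Z) p * x ^ p) (x ^ m / (x - z) ^+ b).
Proof.
move=> zx; have x0 : x != 0 by rewrite -normC_gt0; apply: le_lt_trans zx; apply: normC_ge0.
pose q := m - b%:Z; apply/(abs_conv_Z_above _ (q := q)).
  by move=> p h; rewrite /mon_inf bz_neg ?mul0r //; rewrite /q in h; lia.
have y1 : normC (z / x) < 1.
  by rewrite normCM normCV ltr_pdivrMr ?mul1r // normC_gt0.
have E k : mon_inf z m (- b%:Z) (q - k%:Z) * x ^ (q - k%:Z) =
    x ^ q * ((negbin b k)%:R * (z / x) ^+ k).
  rewrite /mon_inf (_ : m - b%:Z - (q - k%:Z) = k); last by rewrite /q; ring.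
  rewrite bz_nat negbinE -exprnP [(- z) ^+ k]exprNn expfzDr // -invr_expz -exprnP exprMn exprVn.
  rewrite [LHS](_ : _ = ((-1) ^+ k) ^+ 2 * (x ^ q * ((negbin b k)%:R * (z ^+ k / x ^+ k)))); last by ring.
  by rewrite sqrr_sign mul1r.
have -> : x ^ m / (x - z) ^+ b = x ^ q * (1 - z / x) ^- b.
  rewrite (_ : x - z = x * (1 - z / x)); last by field.
  rewrite exprMn invfM mulrA; congr (_ * _).
  by rewrite /q expfzDr // -invr_expz -exprnP.
under eq_fun do rewrite E.
split; [exact/abs_summableM/negbin_summable | exact/sums_toM/negbin_sums].
Qed.

Lemma expand_inf_conv (P : {poly C}) (a b : nat) x : normC z < normC x ->
  abs_conv_Z (fun p => expand_inf z P a b p * x ^ p) (ratfun z P a b x).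
Proof.
move=> zx; have x0 : x != 0 by rewrite -normC_gt0; apply: le_lt_trans zx; apply: normC_ge0.
have -> : (fun p => expand_inf z P a b p * x ^ p) = fun p => \sum_(d < size P)
    P`_d * (mon_inf z (d%:Z - a%:Z) (- b%:Z) p * x ^ p).
  by apply: funext => p; rewrite /expand_inf mulr_suml; apply: eq_bigr => d _; rewrite -mulrA.
rewrite [ratfun _ _ _ _ _](_ : _ = \sum_(d < size P) P`_d * (x ^ (d%:Z - a%:Z) / (x - z) ^+ b)); last first.
  rewrite /ratfun horner_coef mulr_suml; apply: eq_bigr => d _.
  by rewrite expfzDr // -invr_expz -!exprnP invfM !mulrA.
apply: (@abs_conv_Z_sum _ (fun d p => P`_d * (mon_inf z (d%:Z - a%:Z) (- b%:Z) p * x ^ p))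
  (fun d => P`_d * (x ^ (d%:Z - a%:Z) / (x - z) ^+ b))) => d.
exact/abs_conv_ZM/mon_inf_conv.
Qed.

Lemma expand_inf_unique (A : int -> C) (P : {poly C}) (a b : nat) : bounded_above A ->
  (forall x, normC z < normC x -> abs_conv_Z (fun p => A p * x ^ p) (ratfun z P a b x)) ->
  A = expand_inf z P a b.
Proof.
move=> [N AN] h; have [M hM] := expand_inf_bounded z P a b.
pose q := Num.max N M; pose D p := A p - expand_inf z P a b p.
have D0 p : q < p -> D p = 0.
  by rewrite gt_max => /andP[h1 h2]; rewrite /D AN ?hM ?subrr // ltW.
have Dk : forall k, D (q - k%:Z) = 0.
  (* With y = 1/x, the region |x| > |z| becomes the punctured disc of radius 1/|z|, on which the
     difference sums to 0. *)
  apply: (@power_series_eq0 (fun k => D (q - k%:Z)) (normC z)^-1).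
    by rewrite invr_gt0 normC_gt0.
  move=> y y0 yz; pose x := y^-1.
  have x0 : x != 0 by rewrite invr_eq0.
  have zx : normC z < normC x.
    by rewrite normCV -[normC z]invrK ltf_pV2 // posrE ?invr_gt0 normC_gt0.
  have := abs_conv_ZD (h x zx) (abs_conv_ZM (-1) (expand_inf_conv P a b zx)).
  rewrite mulN1r subrr (_ : (fun p => _) = fun p => D p * x ^ p); last first.
    by apply: funext => p; rewrite /D; ring.
  move=> /(abs_conv_Z_above _ (q := q)) [|_ s]; first by move=> p /D0 ->; rewrite mul0r.
  have := sums_toM (x ^ (- q)) s; rewrite mulr0 (_ : (fun k => _) = fun k => D (q - k%:Z) * y ^+ k) //.
  apply: funext => k; rewrite mulrCA -expfzDr // addKr -invr_expz -exprnP /x.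
  by rewrite exprVn invrK.
apply: funext => p; apply/eqP; rewrite -subr_eq0 -/(D p); apply/eqP.
have [/D0 //|le] := ltP q p.
by have := Dk `|q - p|%N; rewrite (_ : q - `|q - p|%N%:Z = p) //; lia.
Qed.
End Convergence.

(** * Linear maps and independence of eigenspaces *)

Section Linear.
Variable R : realType.
Local Notation C := R[i].

Section Maps.
Variables (V M : lmodType C) (T : V -> M).
Hypothesis T_lin : forall (a : C) v w, T (a *: v + w) = a *: T v + T w.

Lemma lin0 : T 0 = 0.
Proof. by have := T_lin (-1) 0 0; rewrite scaler0 addr0 scaleN1r addNr. Qed.

Lemma linZ a v : T (a *: v) = a *: T v.
Proof. by rewrite -[a *: v]addr0 T_lin lin0 addr0. Qed.

Lemma linD v w : T (v + w) = T v + T w.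
Proof. by rewrite -[v]scale1r T_lin !scale1r. Qed.

Lemma lin_sum I (r : seq I) (P : pred I) f : T (\sum_(i <- r | P i) f i) = \sum_(i <- r | P i) T (f i).
Proof. exact: (big_morph T linD lin0). Qed.
End Maps.

Lemma linear_fun0 (M : lmodType C) (alpha : M -> C) : linear_fun alpha -> alpha 0 = 0.
Proof. by move=> h; have := h (-1) 0 0; rewrite scaler0 addr0 mulN1r addNr. Qed.

(** [hom_decomp] picks an arbitrary decomposition, possibly with repeated weights; this makes sums
    over it independent of the choice. Eigenspaces are independent, and [Phi] is additive on each of
    them. *)
Lemma eigen_sum_eq0 (V : lmodType C) (T : V -> V) (n : nat) (M : zmodType)
    (Phi : int -> V -> M) (s : seq (int * V)) :
  (forall (a : C) v w, T (a *: v + w) = a *: T v + T w) ->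
  (size s <= n)%N ->
  (forall (k : int) v w, T v = k%:~R *: v -> T w = k%:~R *: w -> Phi k (v + w) = Phi k v + Phi k w) ->
  (forall p, p \in s -> T p.2 = p.1%:~R *: p.2) ->
  \sum_(p <- s) p.2 = 0 -> \sum_(p <- s) Phi p.1 p.2 = 0.
Proof.
move=> T_lin; elim: n M Phi s => [|n IH] M Phi s.
  by rewrite leqn0 => /nilP -> *; rewrite big_nil.
case: s => [|[k0 v0] s0] hs Phi_add s_eig s_sum; first by rewrite big_nil.
set s := (k0, v0) :: s0 in hs s_eig s_sum *.
(* The effect of T - k0 on the list: terms of weight [k0] disappear, so the induction hypothesis on
   the size applies. *)
pose s1 := [seq (p.1, (p.1 - k0)%:~R *: p.2) | p <- s & p.1 != k0].
have s1_size : (size s1 <= n)%N.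
  by rewrite size_map /s /= eqxx /= size_filter; exact: leq_trans (count_size _ _) (hs : (size s0 <= n)%N).
have nz (k : int) : k != k0 -> (k - k0)%:~R != 0 :> C by rewrite intr_eq0 subr_eq0.
have s1_eig p : p \in s1 -> T p.2 = p.1%:~R *: p.2.
  move=> /mapP[q]; rewrite mem_filter => /andP[_ /s_eig qs] -> /=.
  by rewrite (linZ T_lin) qs !scalerA mulrC.
have s1_sum : \sum_(p <- s1) p.2 = 0.
  rewrite big_map big_filter big_mkcond /=.
  transitivity (T (\sum_(p <- s) p.2) - k0%:~R *: \sum_(p <- s) p.2).
    rewrite (lin_sum T_lin) scaler_sumr -sumrB; apply: eq_big_seq => p /s_eig ->.
    by rewrite -scalerBl -intrB; case: eqVneq => //= ->; rewrite subrr scale0r.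
  by rewrite s_sum scaler0 subr0 (lin0 T_lin).
have off (N : zmodType) (Psi : int -> V -> N) :
    (forall k v w, T v = k%:~R *: v -> T w = k%:~R *: w -> Psi k (v + w) = Psi k v + Psi k w) ->
    \sum_(p <- s | p.1 != k0) Psi p.1 p.2 = 0.
  move=> Psi_add.
  (* The rescaling inside [Psi] undoes the factor k - k0 introduced by T - k0. *)
  have := IH N (fun k v => Psi k ((k - k0)%:~R^-1 *: v)) s1 s1_size _ s1_eig s1_sum.
  rewrite big_map big_filter => h; rewrite -[RHS]h.
    by apply: eq_bigr => p p0 /=; rewrite scalerA mulVf ?scale1r // nz.
  move=> k v w hv hw; rewrite scalerDr Psi_add // (linZ T_lin) ?hv ?hw !scalerA;
  by rewrite mulrC.
have diag : \sum_(p <- s | p.1 == k0) p.2 = 0.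
  have o : \sum_(p <- s | p.1 != k0) p.2 = 0 by exact: (off V (fun _ v => v)).
  by move: s_sum; rewrite (bigID (fun p => p.1 == k0)) /= o addr0.
have Phi0 k : Phi k 0 = 0.
  apply: (addrI (Phi k 0)); rewrite addr0 -Phi_add ?addr0 //; by rewrite (lin0 T_lin) scaler0.
rewrite (bigID (fun p => p.1 == k0)) /= (off M Phi Phi_add) addr0 -[RHS](Phi0 k0) -diag.
rewrite -[LHS]big_filter -[X in Phi k0 X]big_filter.
have : all (fun p => (p.1 == k0) && `[< T p.2 = k0%:~R *: p.2 >]) [seq p <- s | p.1 == k0].
  apply/allP => p; rewrite mem_filter => /andP[/eqP pk /s_eig e].
  by rewrite pk eqxx; apply/asboolP; rewrite e pk.
elim: [seq p <- s | _] => [|p r IHr] /=; first by rewrite !big_nil Phi0.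
move=> /andP[/andP[/eqP pk /asboolP pe] hr]; rewrite !big_cons IHr // pk Phi_add //.
rewrite (lin_sum T_lin) scaler_sumr; apply: eq_big_seq => q /(allP hr) /andP[_ /asboolP].
by [].
Qed.
End Linear.

(** * Opposite vertex operators *)

Section Opposite.
Variable R : realType.
Local Notation C := R[i].
Variables (V : lmodType C) (Y : V -> int -> V -> V) (vac om : V).
Hypothesis VOA : is_VOA Y vac om.
Variables (W : lmodType C) (YW : V -> int -> W -> W).
Hypothesis WM : is_weak_module Y vac YW.

Local Notation L0 := (Lop om Y 0).
Local Notation L1 := (Lop om Y 1).

Lemma mode_linr v n (a : C) w1 w2 : YW v n (a *: w1 + w2) = a *: YW v n w1 + YW v n w2.
Proof. by case: WM => -[]. Qed.

Lemma mode_linl n w (a : C) v1 v2 : YW (a *: v1 + v2) n w = a *: YW v1 n w + YW v2 n w.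
Proof. by case: WM => -[]. Qed.

Lemma mode0l n w : YW 0 n w = 0.
Proof. exact: (lin0 (T := fun v => YW v n w) (mode_linl n w)). Qed.

Lemma Lop_lin k (a : C) v1 v2 : Lop om Y k (a *: v1 + v2) = a *: Lop om Y k v1 + Lop om Y k v2.
Proof. by case: VOA => -[[h _]] *; apply: h. Qed.

Lemma L1_iter_lin k (a : C) v1 v2 : iter k L1 (a *: v1 + v2) = a *: iter k L1 v1 + iter k L1 v2.
Proof. by elim: k => //= k ->; rewrite Lop_lin. Qed.

(** By [L(0), L(1)] = -L(1), each application of L(1) lowers the weight by one. As weights are
    bounded below, the exponential of xL(1) is a finite sum on homogeneous vectors. *)
Lemma L1_iter_weight (n : int) v k :
  L0 v = n%:~R *: v -> L0 (iter k L1 v) = (n - k%:Z)%:~R *: iter k L1 v.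
Proof.
move=> h; elim: k => [|k IH] /=; first by rewrite subr0.
have [_ _ [c hc] _ _] := VOA; have := hc 0 1 (iter k L1 v).
rewrite addr0 => /eqP; rewrite subr_eq => /eqP ->.
rewrite IH (linZ (Lop_lin 1)) add0r -scalerDl -intrD; congr (_%:~R *: _).
by lia.
Qed.

Lemma L1_nilpotent (n : int) v : L0 v = n%:~R *: v ->
  exists K, forall k, (K <= k)%N -> iter k L1 v = 0.
Proof.
move=> h; have [_ _ _ _ [_ _ [N hN]]] := VOA.
exists (absz (n - N)).+1 => k hk; apply: hN (L1_iter_weight k h).
by lia.
Qed.

Definition Yo_term (n : int) v (p : int) w (k : nat) : W :=
  ((-1 : C) ^ n / (k`!)%:R) *: YW (iter k L1 v) (p - k%:Z + 2 * n - 1) w.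

Lemma Yo_homE (n : int) v : L0 v = n%:~R *: v ->
  exists K, forall p w K', (K <= K')%N -> Yo_hom Y om YW n v p w = \sum_(k < K') Yo_term n v p w k.
Proof.
move=> /L1_nilpotent[K hK]; exists K => p w K' h; apply: fsumnE => k hk.
by rewrite hK ?mode0l ?scaler0 // (leq_trans h).
Qed.

Lemma Yo_hom_truncated (n : int) v w : L0 v = n%:~R *: v ->
  exists N : int, forall p, N <= p -> Yo_hom Y om YW n v p w = 0.
Proof.
move=> h; have [K hK] := Yo_homE h; have [_ tr _ _] := WM.
suff [N hN] : exists N : int, forall p (k : 'I_K), N <= p -> Yo_term n v p w k = 0.
  by exists N => p hp; rewrite (hK p w K) // big1 // => k _; apply: hN.
elim: K {hK} => [|K [N hN]]; first by exists 0 => p [].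
have [N' hN'] := tr (iter K L1 v) w.
exists (Num.max N (N' + K%:Z - 2 * n + 1)) => p k; rewrite ge_max => /andP[h1 h2].
have [lt|] := ltnP k K; first exact: (hN p (Ordinal lt)).
rewrite leq_eqVlt ltnNge -ltnS ltn_ord orbF => /eqP <-.
by rewrite /Yo_term hN' ?scaler0 //; lia.
Qed.

Lemma hom_decompP v : v = \sum_(p <- hom_decomp Y om v) p.2 /\
  forall p, p \in hom_decomp Y om v -> L0 p.2 = p.1%:~R *: p.2.
Proof.
rewrite /hom_decomp; case: pselect => [H|[]]; first exact: (projT2 (cid H)).
by have [_ _ _ _ [h _ _]] := VOA; apply: h.
Qed.

Lemma Yo_truncated v w : exists N : int, forall p, N <= p -> Yo Y om YW v p w = 0.
Proof.
have [_] := hom_decompP v; rewrite /Yo; elim: (hom_decomp Y om v) => [|q s IH] eig.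
  by exists 0 => p _; rewrite big_nil.
have [N hN] := IH (fun p h => eig p (mem_behead (s := q :: s) h)).
have [N' hN'] := Yo_hom_truncated w (eig q (mem_head _ _)).
exists (Num.max N N') => p; rewrite ge_max => /andP[h1 h2].
by rewrite big_cons hN // hN' // addr0.
Qed.

Lemma Yo0 v p : Yo Y om YW v p 0 = 0.
Proof.
apply: big1_seq => q /andP[_ /(proj2 (hom_decompP v)) h].
have [K E] := Yo_homE h; rewrite (E _ _ K) // big1 // => k _; rewrite /Yo_term (lin0 (T := YW _ _)) ?scaler0 //.
exact: mode_linr.
Qed.

(** The vacuum has weight 0 and is killed by L(1), so on the decomposition consisting of the vacuum
    alone the formula gives the identity. *)
Lemma Yo_vac p w : Yo Y om YW vac p w = if p == 0 then w else 0.
Proof.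
have [_ create _ _ _] := VOA.
have Lvac k : 0 <= k -> Lop om Y k vac = 0 by move=> h; apply: (create om).1; lia.
have [dec eig] := hom_decompP vac; rewrite /Yo.
set s := hom_decomp Y om vac in dec eig *.
have hom0 : Yo_hom Y om YW 0 (- vac) p w = - (if p == 0 then w else 0).
  rewrite /Yo_hom (fsumn_only (k0 := 0%N)); last first.
    case=> // k _; rewrite iterSr -scaleN1r (linZ (Lop_lin 1)) Lvac // scaler0.
    rewrite (lin0 (T := iter k L1)) ?mode0l ?scaler0 //; exact: L1_iter_lin.
  rewrite (_ : p - 0%:Z + 2 * 0 - 1 = p - 1); last by ring.
  rewrite fact0 expr0z divr1 scale1r /= -scaleN1r.
  have [_ _ vacW _] := WM.
  rewrite (linZ (T := fun v => YW v (p - 1) w)) ?vacW ?scaleN1r; last exact: mode_linl.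
  by rewrite (_ : (p - 1 == -1) = (p == 0)) //; lia.
(* Appending [(0, - vac)] to the chosen decomposition gives a list with sum zero, which compares it
   with the obvious one. *)
have := @eigen_sum_eq0 _ V L0 _ W (fun n v => Yo_hom Y om YW n v p w) (rcons s (0, - vac))
  (Lop_lin 0) (leqnn _).
rewrite !big_rcons /= hom0 -dec subrr => h.
apply/eqP; rewrite -subr_eq0; apply/eqP; apply: h => //.
  move=> k v1 v2 h1 h2; have h12 : L0 (v1 + v2) = k%:~R *: (v1 + v2).
    by rewrite (linD (Lop_lin 0)) h1 h2 scalerDr.
  have [K1 E1] := Yo_homE h1; have [K2 E2] := Yo_homE h2; have [K3 E3] := Yo_homE h12.
  pose K := maxn K1 (maxn K2 K3).
  rewrite (E1 _ _ K) ?(E2 _ _ K) ?(E3 _ _ K) ?leq_max ?leqnn ?orbT //.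
  rewrite -big_split; apply: eq_bigr => i _ /=.
  rewrite /Yo_term (linD (T := iter i L1)); last exact: L1_iter_lin.
  by rewrite (linD (T := fun v => YW v _ w)) ?scalerDr //; exact: mode_linl.
move=> q; rewrite mem_rcons inE => /orP[/eqP ->|/eig //] /=.
by rewrite -scaleN1r (linZ (Lop_lin 0)) Lvac // scaler0 scale0r.
Qed.
End Opposite.

(** * P(z)-linear functionals and intertwining maps *)

Section Functionals.
Variable R : realType.
Local Notation C := R[i].
Variables (V : lmodType C) (Y : V -> int -> V -> V) (vac om : V).
Hypothesis VOA : is_VOA Y vac om.
Variables (W : lmodType C) (YW : V -> int -> W -> W).
Hypothesis WM : is_weak_module Y vac YW.
Variable z : C.
Hypothesis z0 : z != 0.
Implicit Types (alpha : W -> C) (P : {poly C}).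

Local Notation pairing v alpha w := (fun p => alpha (Yo Y om YW v p w)).

Lemma pairing_bounded v alpha w : alpha 0 = 0 -> bounded_above (pairing v alpha w).
Proof. by move=> a0; have [N hN] := Yo_truncated VOA WM v w; exists N => p /hN ->. Qed.

Lemma expand_represents v alpha w P a b :
  pairing v alpha w = expand_inf z P a b -> represents Y om YW z v alpha w (P, a, b).
Proof.
move=> E x zx; rewrite (_ : (fun p => _) = fun p => expand_inf z P a b p * x ^ p).
  exact: expand_inf_conv.
by apply: funext => p; rewrite -E.
Qed.

(* The expansions at 0 and z do not depend on the representative chosen by [fsel]. *)
Lemma YR_YL_expand v alpha w P a b : alpha 0 = 0 ->
  represents Y om YW z v alpha w (P, a, b) ->
  forall r, YR Y om YW z v r alpha w = expand_0 z P a b r /\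
            YL Y om YW z v r alpha w = expand_z z P a b r.
Proof.
move=> alpha0 rep r; have bA := pairing_bounded v w alpha0.
have E := expand_inf_unique z0 bA rep.
rewrite /YR /YL /fsel; case: pselect => [H|[]]; last by exists (P, a, b).
case: (cid H) => -[[P' a'] b'] /= rep'.
have E' := expand_inf_unique z0 bA rep'.
have J := Jac_expand z0 P a b; have := Jac_expand z0 P' a' b'; rewrite -E' {1}E /= => J'.
have [e0 ez] := Jac_unique z0 (iota0_bounded _ _ _ _) (iota0_bounded _ _ _ _)
  (iota0_bounded _ _ _ _) (iota0_bounded _ _ _ _) J' J.
by split; [rewrite -[RHS](congr1 (@^~ r) e0) | rewrite -[RHS](congr1 (@^~ r) ez)].
Qed.

(** [YR_YL_expand] asks of a functional that it vanish at 0; this allows its consequences to be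
    applied to [YR v r alpha] in turn, as in the composite defining [YPz]. *)
Lemma YR_at0 v r alpha : alpha 0 = 0 -> YR Y om YW z v r alpha 0 = 0.
Proof.
move=> alpha0; have [|-> _] := @YR_YL_expand v alpha 0 0 0 0 alpha0 _ r.
  apply: expand_represents; apply: funext => p.
  by rewrite (Yo0 VOA WM) alpha0 /expand_inf size_poly0 big_ord0.
by rewrite /expand_0 iota0E size_poly0 big_ord0.
Qed.

Lemma YL_zero v r w : YL Y om YW z v r (fun _ => 0) w = 0.
Proof.
have [|_ ->] := @YR_YL_expand v (fun _ => 0) w 0 0 0 erefl _ r.
  by apply: expand_represents; apply: funext => p; rewrite /expand_inf size_poly0 big_ord0.
by rewrite /expand_z comp_poly0 iota0E size_poly0 big_ord0.
Qed.

Lemma iota0_const (c y : C) r : iota0 c%:P 0 0 y r = if r == 0 then c else 0.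
Proof.
rewrite iota0E -(coefs_widen (fun d => mon0 y (d%:Z - 0%:Z) (- 0%:Z) r) (size_polyC_leq1 c)).
rewrite big_ord1 coefC eqxx /mon0 oppr0 bz0l !subr0.
by case: eqVneq => [->|_]; rewrite ?expr0z ?mulr1 // mul0r mulr0.
Qed.

Lemma vac_pairing alpha w : alpha 0 = 0 -> pairing vac alpha w = expand_inf z (alpha w)%:P 0 0.
Proof.
move=> alpha0; apply: funext => p; rewrite (Yo_vac VOA WM).
rewrite /expand_inf -(coefs_widen (fun d => mon_inf z (d%:Z - 0%:Z) (- 0%:Z) p) (size_polyC_leq1 _)).
rewrite big_ord1 coefC eqxx /mon_inf oppr0 subr0 !add0r bz0l oppr_eq0.
by case: eqVneq => [->|_]; rewrite ?oppr0 ?expr0z ?mulr1 // mul0r mulr0.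
Qed.

Lemma YR_vac alpha r : alpha 0 = 0 ->
  YR Y om YW z vac r alpha = if r == 0 then alpha else fun _ => 0.
Proof.
move=> alpha0; apply: funext => w.
have [-> _] := YR_YL_expand alpha0 (expand_represents (vac_pairing w alpha0)) r.
by rewrite /expand_0 iota0_const; case: eqP.
Qed.

Lemma YL_vac alpha r w : alpha 0 = 0 ->
  YL Y om YW z vac r alpha w = if r == 0 then alpha w else 0.
Proof.
move=> alpha0.
have [_ ->] := YR_YL_expand alpha0 (expand_represents (vac_pairing w alpha0)) r.
by rewrite /expand_z comp_polyC iota0_const.
Qed.
End Functionals.

(** * The two directions of the equivalence *)

Section IntertwiningMaps.
Variable R : realType.
Local Notation C := R[i].
Variables (V : lmodType C) (Y : V -> int -> V -> V) (vac om : V).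
Hypothesis VOA : is_VOA Y vac om.
Variables (W1 W2 W : lmodType C).
Variables (Y1 : V -> int -> W1 -> W1) (Y2 : V -> int -> W2 -> W2) (YW : V -> int -> W -> W).
Hypotheses (M1 : is_weak_module Y vac Y1) (M2 : is_weak_module Y vac Y2).
Hypothesis (MW : is_weak_module Y vac YW).
Variable z : C.
Hypothesis z0 : z != 0.
Variable F : W1 -> W2 -> W -> C.
Hypothesis F_bilin : bilinear_dual F.

Let F0l w2 w : F 0 w2 w = 0.
Proof. by have [h _ _] := F_bilin; have := h (-1) 0 0 w2 w; rewrite scaler0 addr0 mulN1r addNr. Qed.

Let F0r w1 w : F w1 0 w = 0.
Proof. by have [_ h _] := F_bilin; have := h (-1) w1 0 0 w; rewrite scaler0 addr0 mulN1r addNr. Qed.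

Let F0 w1 w2 : F w1 w2 0 = 0.
Proof. by have [_ _ h] := F_bilin; apply: linear_fun0. Qed.

Definition coefA v w1 w2 w (p : int) := F w1 w2 (Yo Y om YW v p w).
Definition coefG v w1 w2 w (p : int) := F w1 (Y2 v (- p - 1) w2) w.
Definition coefH v w1 w2 w (p : int) := F (Y1 v (- p - 1) w1) w2 w.

Lemma intertwiningP : is_intertwining Y om Y1 Y2 YW z F <->
  forall v w1 w2 w, Jac z (coefA v w1 w2 w) (coefG v w1 w2 w) (coefH v w1 w2 w).
Proof.
have E2 v w1 w2 w l r : (fun i : nat => binz R l i * z ^ (l - i%:Z) * (-1) ^+ i * F w1 (Y2 v (i%:Z - r - 1) w2) w)
    = fun i => binz R l i * z ^ (l - i%:Z) * (-1) ^+ i * coefG v w1 w2 w (r - i%:Z).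
  by apply: funext => i; rewrite /coefG opprB.
have E3 v w1 w2 w l r : (fun i : nat => z ^ (- r - i%:Z - 1) * binz R (r + i%:Z) i * (-1) ^+ i * F (Y1 v (l + i%:Z) w1) w2 w)
    = fun i => z ^ (- r - i%:Z - 1) * binz R (r + i%:Z) i * (-1) ^+ i * coefH v w1 w2 w (- l - 1 - i%:Z).
  apply: funext => i; rewrite /coefH; congr (_ * F (Y1 v _ w1) w2 w).
  by ring.
split=> h v w1 w2 w; first by move=> l r; have := h v w1 w2 w l r; rewrite E2 E3.
by move=> l r; rewrite E2 E3; apply: h.
Qed.

(** Truncation in the second module bounds the pole at 0 before [w] is chosen; this is the
    uniformity that P(z)-linear functionals require. *)
Lemma coefG_bounded v w1 w2 : exists a : nat, forall w p, p < - a%:Z -> coefG v w1 w2 w p = 0.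
Proof.
have [_ tr _ _] := M2; have [N hN] := tr v w2; exists `|N|%N => w p h.
by rewrite /coefG hN ?F0r //; lia.
Qed.

Lemma coefH_bounded v w1 w2 : exists b : nat, forall w p, p < - b%:Z -> coefH v w1 w2 w p = 0.
Proof.
have [_ tr _ _] := M1; have [N hN] := tr v w1; exists `|N|%N => w p h.
by rewrite /coefH hN ?F0l //; lia.
Qed.

Lemma intertwining_expand : is_intertwining Y om Y1 Y2 YW z F ->
  forall v w1 w2, exists a b : nat, forall w, exists P,
    [/\ coefA v w1 w2 w = expand_inf z P a b, coefG v w1 w2 w = expand_0 z P a b &
        coefH v w1 w2 w = expand_z z P a b].
Proof.
move=> /intertwiningP J v w1 w2.
have [a ha] := coefG_bounded v w1 w2; have [b hb] := coefH_bounded v w1 w2.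
exists a, b => w.
have bA : bounded_above (coefA v w1 w2 w) by apply: (pairing_bounded VOA MW).
have [P E] := Jac_rational z0 bA (ha w) (hb w) (J v w1 w2 w).
have := J v w1 w2 w; rewrite E => J1.
exists P; have [||e0 ez] := Jac_unique z0 _ _ (iota0_bounded _ _ _ _) (iota0_bounded _ _ _ _)
  J1 (Jac_expand z0 P a b) => //.
  by exists (- a%:Z - 1) => p h; apply: ha; lia.
by exists (- b%:Z - 1) => p h; apply: hb; lia.
Qed.

Lemma intertwining_hom : is_intertwining Y om Y1 Y2 YW z F -> is_hom_to_D Y om Y1 Y2 YW z F.
Proof.
move=> /intertwining_expand E.
have rep v w1 w2 w P a b : coefA v w1 w2 w = expand_inf z P a b ->
    represents Y om YW z v (F w1 w2) w (P, a, b) by exact: expand_represents.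
have YE v w1 w2 w r : YR Y om YW z v r (F w1 w2) w = coefG v w1 w2 w r /\
    YL Y om YW z v r (F w1 w2) w = coefH v w1 w2 w r.
  have [a [b /(_ w)[P [EA EG EH]]]] := E v w1 w2.
  by rewrite EG EH; apply: (YR_YL_expand VOA MW) => //; apply: rep.
split=> [w1 w2|u v w1 w2 r w].
  split; first by case: F_bilin.
  move=> v; have [a [b h]] := E v w1 w2; exists a, b => w.
  by have [P [/rep]] := h w; exists P.
rewrite /YPz; congr fsumz; apply: funext => t.
(* The right action produces again a value of [F], so the left action can be computed from [YE] at
   the new arguments. *)
rewrite (_ : YR Y om YW z v t (F w1 w2) = F w1 (Y2 v (- t - 1) w2)).
  by have [_ ->] := YE u w1 (Y2 v (- t - 1) w2) w (r - t); rewrite /coefH opprB.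
by apply: funext => w'; have [->] := YE v w1 w2 w' t.
Qed.

Lemma hom_intertwining : is_hom_to_D Y om Y1 Y2 YW z F -> is_intertwining Y om Y1 Y2 YW z F.
Proof.
move=> [D hom]; have [_ _ vac1 _] := M1; have [_ _ vac2 _] := M2.
(* Taking u = 1 collapses both sums over [t] to t = r and isolates the right action. *)
have YRE v w1 w2 w r : YR Y om YW z v r (F w1 w2) w = coefG v w1 w2 w r.
  have := hom vac v w1 w2 r w; rewrite /YPz (fsumz_only (t0 := r)); last first.
    move=> t tr; rewrite vac1 (_ : (_ == _) = false) ?F0l //.
    by apply: contraNF tr => /eqP h; apply/eqP; lia.
  rewrite (fsumz_only (t0 := r)); last first.
    move=> t tr; rewrite (YL_vac VOA MW z0) ?(YR_at0 VOA MW) //.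
    by rewrite subr_eq0 eq_sym (negbTE tr).
  rewrite (YL_vac VOA MW z0) ?(YR_at0 VOA MW) // subrr eqxx => <-.
  by rewrite vac1 sub0r eqxx.
(* Taking the second vector to be the vacuum collapses both sums to t = 0 and isolates the left
   action. *)
have YLE v w1 w2 w r : YL Y om YW z v r (F w1 w2) w = coefH v w1 w2 w r.
  have := hom v vac w1 w2 r w; rewrite /YPz (fsumz_only (t0 := 0)); last first.
    move=> t t0; rewrite vac2 (_ : (_ == _) = false) ?F0r //.
    by apply: contraNF t0 => /eqP h; apply/eqP; lia.
  rewrite (fsumz_only (t0 := 0)); last first.
    by move=> t t0; rewrite (YR_vac VOA MW) // (negbTE t0) (YL_zero VOA MW).
  by rewrite (YR_vac VOA MW) // eqxx subr0 vac2 oppr0 !sub0r eqxx => <-.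
apply/intertwiningP => v w1 w2 w.
have [_ /(_ v) [a [b /(_ w) [P rep]]]] := D w1 w2.
have YE := YR_YL_expand VOA MW z0 (F0 w1 w2) rep.
have -> : coefG v w1 w2 w = expand_0 z P a b.
  by apply: funext => r; rewrite -YRE; case: (YE r).
have -> : coefH v w1 w2 w = expand_z z P a b.
  by apply: funext => r; rewrite -YLE; case: (YE r).
(* Convergence to the rational function on |x| > |z| is turned into an equality of coefficients. *)
have -> : coefA v w1 w2 w = expand_inf z P a b.
  by apply: (expand_inf_unique z0) => //; apply: (pairing_bounded VOA MW).
exact: Jac_expand.
Qed.
End IntertwiningMaps.

Unset Implicit Arguments.
Set Strict Implicit.

Theorem theorem4p5 (R : realType) (V : lmodType R[i]) (Y : V -> int -> V -> V)
  (vac om : V) (W1 W2 W : lmodType R[i])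
  (Y1 : V -> int -> W1 -> W1) (Y2 : V -> int -> W2 -> W2) (YW : V -> int -> W -> W)
  (z : R[i]) (F : W1 -> W2 -> W -> R[i]) :
  is_VOA Y vac om ->
  is_gen_module Y vac om Y1 -> is_gen_module Y vac om Y2 -> is_gen_module Y vac om YW ->
  z != 0 ->
  bilinear_dual F ->
  (is_intertwining Y om Y1 Y2 YW z F <-> is_hom_to_D Y om Y1 Y2 YW z F).
Proof.
move=> VOA [M1 _] [M2 _] [MW _] z0 bF; split; first exact: (intertwining_hom VOA).
exact: (hom_intertwining VOA).
Qed.
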